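(* For an integer $t$ put $j=j(t)=20t-3$ and let $E_{j(t)}$ be the Weierstrass equation $$\begin{aligned} y^2 - x^2y ={}& (40960000000000 - 14580000000\, j^5 + 531441\, j^{10})\, x^6 - (86400000000\, j^2 - 39366000\, j^7)\,x^5\\ & - \left(\tfrac14 + 48600000\, j^4 + \tfrac{177147\, j^9}{4}\right)x^4 + (320000000\, j + 291600\, j^6)\,x^3 - 1350000\, j^3\, x^2\\ & + (1600000 + 243\, j^5)\,x - 500\, j^2 . \end{aligned}$$ Then, for every integer $t$, $E_{j(t)}$ describes a genus $2$ curve with everywhere good reduction over either of the extensions $K=\mathbb{Q}\left(\sqrt{\pm(-3200000 + 729\, j(t)^5)}\right)$ (i.e. for each choice of sign).
   Context: A Weierstrass equation $y^2+Q(x)y=P(x)$ over a field $F$, with $\deg Q\le3$, $\deg P\le 6$, describes the smooth projective curve it defines. For a number field $K$ and a prime $\mathfrak p$ of $K$ with completion $K_{\mathfrak p}$, a genus $2$ curve $C$ over $K$ has good reduction at $\mathfrak p$ if $C$ can be described over $K_{\mathfrak p}$ by a Weierstrass equation $y^2+Q(x)y=P(x)$ with $P,Q\in\mathcal{O}_{K_{\mathfrak p}}[x]$ and $2^{-12}\operatorname{disc}_6(4P+Q^2)\in\mathcal{O}_{K_{\mathfrak p}}^\times$, where $\operatorname{disc}_6$ is the discriminant as a binary sextic form (for $4P+Q^2=a_0x^6+a_1x^5+\cdots$ it is the usual discriminant if $a_0\neq0$, and $a_1^2$ times the usual discriminant if $a_0=0$). $C$ has everywhere good reduction over $K$ if (after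 base change to $K$) it has good reduction at every prime of $K$. *)

(* Defs.v *)
From mathcomp Require Import all_boot all_order all_algebra all_field.
Set Implicit Arguments.
Unset Strict Implicit.
Unset Printing Implicit Defensive.
Import Order.TTheory GRing.Theory Num.Theory.
Local Open Scope ring_scope.

(** * Weierstrass equations y^2 + Q(x) y = P(x) and the curves they define *)

Record weierstrass (F : fieldType) :=
  Weierstrass { wQ : {poly F}; wP : {poly F} }.

Definition base_change (F F' : fieldType) (f : {rmorphism F -> F'})
    (W : weierstrass F) : weierstrass F' :=
  Weierstrass (map_poly f (wQ W)) (map_poly f (wP W)).

Definition evalp (F L : fieldType) (iota : {rmorphism F -> L}) (x : L)
    (h : {poly F}) : L :=
  (map_poly iota h).[x].

(** A smooth projective curve over [F] is represented by its function field,
    an extension [iota : F -> L].  [function_field_of W iota x y] says that [L]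
    is the fraction field of F[x, y] / (y^2 + Q y - P), this polynomial being
    irreducible over F(x): the smooth projective curve with function field
    [L / F] is then the one defined by [W], with coordinate functions x, y. *)
Record function_field_of (F L : fieldType) (W : weierstrass F)
    (iota : {rmorphism F -> L}) (x y : L) : Prop := FunctionFieldOf {
  ff_degQ : (size (wQ W) <= 4)%N;
  ff_degP : (size (wP W) <= 7)%N;
  ff_eq : y ^+ 2 + evalp iota x (wQ W) * y = evalp iota x (wP W);
  ff_transcendental : forall h : {poly F}, evalp iota x h = 0 -> h = 0;
  ff_irreducible : forall h k : {poly F},
    k <> 0 -> y * evalp iota x k <> evalp iota x h;
  ff_generated : forall z : L, exists a b c : {poly F},
    c <> 0 /\ z * evalp iota x c = evalp iota x a + evalp iota x b * y }.

(** Smooth projective curves are isomorphic over [F] exactly when their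
    function fields are, so this says that the two equations describe the same
    curve over [F]. *)
Definition same_curve (F : fieldType) (W W' : weierstrass F) : Prop :=
  exists (L : fieldType) (iota : {rmorphism F -> L}) (x y x' y' : L),
    function_field_of W iota x y /\ function_field_of W' iota x' y'.

(** * Genus *)

(** Let X be the normal projective curve with function field [L / F] (smooth
    when F is perfect) and let x : X -> P^1 be a nonconstant function.  X is the
    union of the affine opens U = {x <> oo} and V = {x <> 0}, whose coordinate
    rings are the integral closures in L of F[x] and F[1/x], and the ring of
    the intersection is the integral closure of F[x, 1/x]. *)
Definition ring_U (F L : fieldType) (iota : {rmorphism F -> L}) (x z : L) :=
  integralOver (evalp iota x) z.

Definition ring_V (F L : fieldType) (iota : {rmorphism F -> L}) (x z : L) :=
  integralOver (evalp iota x^-1) z.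

Definition ring_UV (F L : fieldType) (iota : {rmorphism F -> L}) (x z : L) :=
  integralOver
    (fun h : {poly {poly F}} => (map_poly (evalp iota x) h).[x^-1]) z.

(** H^0(X, O_X) = O(U) `&` O(V) is equal to F. *)
Definition H0_trivial (F L : fieldType) (iota : {rmorphism F -> L}) (x : L) :=
  forall z : L, ring_U iota x z -> ring_V iota x z -> exists c : F, z = iota c.

(** H^1(X, O_X) = O(U `&` V) / (O(U) + O(V)) has dimension g over F: the classes
    of w_0, ..., w_(g-1) form a basis. *)
Definition H1_dim (F L : fieldType) (iota : {rmorphism F -> L}) (x : L)
    (g : nat) :=
  exists w : 'I_g -> L,
    (forall i, ring_UV iota x (w i)) /\
    (forall z : L, ring_UV iota x z ->
       exists! c : 'rV[F]_g, exists a b : L,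
         ring_U iota x a /\ ring_V iota x b /\
         z = a + b + \sum_(i < g) iota (c 0 i) * w i).

(** In characteristic 0 the condition H^0(X, O_X) = F is equivalent to X being
    geometrically irreducible. *)
Definition describes_genus (F : fieldType) (g : nat) (W : weierstrass F) :=
  exists (L : fieldType) (iota : {rmorphism F -> L}) (x y : L),
    [/\ function_field_of W iota x y, H0_trivial iota x & H1_dim iota x g].

(** * Discriminants *)

Definition discr (F : fieldType) (f : {poly F}) : F :=
  let n := (size f).-1 in
  (-1) ^+ 'C(n, 2) * resultant f f^`() / lead_coef f.

(** Discriminant as a binary sextic form.  In the notation
    f = a_0 x^6 + a_1 x^5 + ..., a_0 is [f`_6] and a_1 is [f`_5]. *)
Definition disc6 (F : fieldType) (f : {poly F}) : F :=
  if f`_6 != 0 then discr f else f`_5 ^+ 2 * discr f.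

Definition wdisc (F : fieldType) (W : weierstrass F) : F :=
  2 ^- 12 * disc6 (4 *: wP W + wQ W ^+ 2).

(** * Primes and completions of a number field *)

Definition ring_of_integers (K : fieldExtType rat) (z : K) : Prop :=
  integralOver (fun m : int => m%:~R : K) z.

Record is_prime (K : fieldExtType rat) (p : K -> Prop) : Prop := IsPrime {
  prime_int : forall a, p a -> ring_of_integers a;
  prime_sub : forall a b, p a -> p b -> p (a - b);
  prime_mul : forall a b, ring_of_integers a -> p b -> p (a * b);
  prime_proper : ~ p 1;
  prime_prime : forall a b, ring_of_integers a -> ring_of_integers b ->
    p (a * b) -> p a \/ p b;
  prime_nonzero : exists a, p a /\ a <> 0 }.

(** Normalized discrete valuations; the value [v 0] is irrelevant, and
    [vge v n x] stands for "v(x) >= n" with v(0) = +oo. *)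
Definition vge (L : fieldType) (v : L -> int) (n : int) (x : L) : Prop :=
  x = 0 \/ n <= v x.

Record discrete_valuation (L : fieldType) (v : L -> int) : Prop :=
  DiscreteValuation {
  dv_mul : forall x y, x <> 0 -> y <> 0 -> v (x * y) = v x + v y;
  dv_add : forall n x y, vge v n x -> vge v n y -> vge v n (x + y);
  dv_uniformizer : exists x, x <> 0 /\ v x = 1 }.

Definition vcauchy (L : fieldType) (v : L -> int) (u : nat -> L) : Prop :=
  forall N : int, exists n0 : nat, forall m n : nat,
    (n0 <= m)%N -> (n0 <= n)%N -> vge v N (u m - u n).

Definition vlimit (L : fieldType) (v : L -> int) (u : nat -> L) (l : L) : Prop :=
  forall N : int, exists n0 : nat, forall n : nat,
    (n0 <= n)%N -> vge v N (u n - l).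

(** [Kp], with its normalized valuation [v] and the embedding [iota], is the
    completion of [K] at [p].  By [comp_int] and [comp_prime] the valuation
    ring of [v \o iota] contains the localization of the integers of [K] at
    [p]; the latter being a discrete valuation ring, they are equal, so that
    [v \o iota] is the p-adic valuation. *)
Record is_completion (K : fieldExtType rat) (p : K -> Prop) (Kp : fieldType)
    (iota : {rmorphism K -> Kp}) (v : Kp -> int) : Prop := IsCompletion {
  comp_dv : discrete_valuation v;
  comp_int : forall z, ring_of_integers z -> vge v 0 (iota z);
  comp_prime : forall z, ring_of_integers z -> (p z <-> vge v 1 (iota z));
  comp_dense : forall (x : Kp) (N : int), exists z : K, vge v N (x - iota z);
  comp_complete : forall u : nat -> Kp, vcauchy v u -> exists l, vlimit v u l }.

(** * Good reduction *)

Definition integral_poly (L : fieldType) (v : L -> int) (h : {poly L}) : Prop :=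
  forall i : nat, vge v 0 h`_i.

Definition vunit (L : fieldType) (v : L -> int) (x : L) : Prop :=
  x <> 0 /\ v x = 0.

(** Completions exist and are unique up to unique isomorphism, so quantifying
    over all of them is the same as choosing one. *)
Definition good_reduction_at (K : fieldExtType rat) (W : weierstrass K)
    (p : K -> Prop) : Prop :=
  forall (Kp : fieldType) (iota : {rmorphism K -> Kp}) (v : Kp -> int),
    is_completion p iota v ->
    exists W' : weierstrass Kp,
      [/\ same_curve (base_change iota W) W',
          integral_poly v (wP W'), integral_poly v (wQ W')
        & vunit v (wdisc W')].

Definition everywhere_good_reduction (K : fieldExtType rat)
    (W : weierstrass K) : Prop :=
  forall p : K -> Prop, is_prime p -> good_reduction_at W p.

(** * The family E_j *)

(** Numerals of [ring_scope] are unary, so the large coefficients are factored: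
      40960000000000 = 4096 * 10^10    14580000000 = 1458 * 10^7
      531441 = 3^12                    86400000000 = 864 * 10^8
      39366000 = 2 * 3^9 * 10^3        48600000 = 486 * 10^5
      177147 = 3^11                    320000000 = 32 * 10^7
      291600 = 2916 * 10^2             1350000 = 135 * 10^4
      1600000 = 16 * 10^5              3200000 = 32 * 10^5 *)
Definition E (j : rat) : weierstrass rat :=
  Weierstrass
    (- 'X^2)
    ((4096 * 10 ^+ 10 - 1458 * 10 ^+ 7 * j ^+ 5 + 3 ^+ 12 * j ^+ 10) *: 'X^6
     - (864 * 10 ^+ 8 * j ^+ 2 - 2 * 3 ^+ 9 * 10 ^+ 3 * j ^+ 7) *: 'X^5
     - (1 / 4 + 486 * 10 ^+ 5 * j ^+ 4 + 3 ^+ 11 * j ^+ 9 / 4) *: 'X^4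
     + (32 * 10 ^+ 7 * j + 2916 * 10 ^+ 2 * j ^+ 6) *: 'X^3
     - (135 * 10 ^+ 4 * j ^+ 3) *: 'X^2
     + (16 * 10 ^+ 5 + 243 * j ^+ 5) *: 'X
     - (500 * j ^+ 2)%:P).

Definition jt (t : int) : rat := (20 * t - 3)%:~R.

Definition radicand (j : rat) : rat := - (32 * 10 ^+ 5) + 729 * j ^+ 5.

(* Main.v *)
Require Import Defs.
From Stdlib Require Import BinInt.
From HB Require Import structures.
From mathcomp Require Import all_boot all_order all_algebra all_field.
From mathcomp Require Import ring zify ssrZ.
Set Implicit Arguments.
Unset Strict Implicit.
Unset Printing Implicit Defensive.
Import Order.TTheory GRing.Theory Num.Theory.
Local Open Scope ring_scope.

(** Write f = 4 P + Q^2 for the equation E_j, and put A = 729 j^5 - 3200000,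
    w = 729 j^5 / 3200000 and r = 9 j^2 / 8000, so that w - 1 = A / 3200000.
    Then f(r X) = 400 j^2 G(X), where G is a sextic over Z[w] ([sextic]) of
    discriminant - 2^22 3^12 5^5 w^8 (w - 1)^15 ([discr_sextic]); the powers of
    j cancel and 2^-12 disc_6(f) = - A^15 ([wdisc_family]).

    Let j = 20 t - 3.  As j is 1 modulo 4, the coefficients of P are integers,
    so E_j itself has good reduction at the primes that do not divide A.  At a
    prime dividing A, the congruence A = 13 modulo 20 shows that 2 and 5 are
    units, and then A = 729 j^5 - 2^10 5^5 shows that 3 and j, hence w and r,
    are units too.  There w is congruent to 1, and G(1 + Z) has its coefficient
    of Z^i divisible by (w - 1)^((6 - i) / 2), the exponent being rounded up:
    modulo A, f is a constant times (x - r)^6.  In K one has A = +-s^2, so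
    x = r + s X, y = s^3 Y makes the equation Y^2 = s^-6 f(r + s X) integral,
    while the discriminant - A^15 is divided by s^30 = +-A^15
    ([bad_prime_integral], [wdisc_scaled], [good_model]).

    For the genus, let Y = 2 y + Q, so that Y^2 = f(x) with f separable.  If
    u + v Y is integral over a ring of functions of x, so are its trace 2 u and
    its norm u^2 - v^2 f.  Over F[x] this gives O(U) = F[x] + F[x] Y
    ([ring_UP]).  At infinity a bound on the degrees of 2 u and of the norm is
    enough ([pole_order_integral], [ring_V_regular]), since f has degree 6.
    Finally Y / x^3 is integral over F[1/x], so in O(U `&` V) only Y / x and
    Y / x^2 are missing from O(U) + O(V), and the genus is 2
    ([H1_dim_curve]). *)

(** * Resultants under affine substitutions *)

(** The Sylvester matrix in prescribed formal degrees m and n: the sizes of p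
    and q do not enter its type, so it can be transformed without casts. *)
Definition sylv (R : comNzRingType) (m n : nat) (p q : {poly R}) : 'M[R]_(n + m) :=
  col_mx (lin1_mx (poly_rV \o p \o* rVpoly)) (lin1_mx (poly_rV \o q \o* rVpoly)).

Lemma sylvE (R : comNzRingType) (m n : nat) (p q : {poly R}) i j :
  sylv m n p q i j = if (i < n)%N then p`_(j - i) *+ (i <= j)%N
                       else q`_(j - (i - n)) *+ (i - n <= j)%N.
Proof.
rewrite /sylv mxE; case: splitP => k ->; rewrite ?ltn_ord ?ltnNge ?leq_addr /=.
  by rewrite !mxE /= rVpoly_delta coefXnM ltnNge if_neg -mulrb.
by rewrite addKn !mxE /= rVpoly_delta coefXnM ltnNge if_neg -mulrb.
Qed.

Lemma resultant_sylv (R : comNzRingType) (m n : nat) (p q : {poly R}) :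
  size p = m.+1 -> size q = n.+1 -> resultant p q = \det (sylv m n p q).
Proof.
by move=> sp sq; rewrite /resultant /Sylvester_mx /sylv sp sq.
Qed.

Section AffineSubstitution.
Variables (R : idomainType) (a b : R).
Hypothesis nz_a : a != 0.
Local Notation aff := (a *: 'X + b%:P).

Lemma size_affine : size aff = 2.
Proof. by rewrite -mul_polyC size_MXaddC polyC_eq0 (negPf nz_a) size_polyC nz_a. Qed.

Lemma size_affine_exp i : size (aff ^+ i) = i.+1.
Proof.
rewrite polySpred ?size_exp ?size_affine ?mul1n // expf_neq0 //.
by rewrite -size_poly_eq0 size_affine.
Qed.

Lemma lead_coef_affine : lead_coef aff = a.
Proof. by rewrite lead_coefE size_affine coefD coefZ coefX coefC mulr1 addr0. Qed.

(** The matrix of p |-> p(a X + b) on polynomials of degree less than n, acting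
    on rows of coefficients. *)
Definition comp_mx n : 'M[R]_n := lin1_mx (poly_rV \o comp_poly aff \o rVpoly).

Lemma det_comp_mx n : \det (comp_mx n) = \prod_(i < n) a ^+ i.
Proof.
have E i j : comp_mx n i j = (aff ^+ i)`_j.
  by rewrite !mxE /= rVpoly_delta comp_Xn_poly.
rewrite det_trig.
  apply: eq_bigr => i _; rewrite E -[X in _`_X]/((i.+1).-1) -size_affine_exp.
  by rewrite -lead_coefE lead_coef_exp lead_coef_affine.
apply/is_trig_mxP => i j lt_ij; rewrite E nth_default //.
by rewrite size_affine_exp.
Qed.

Lemma size_comp_affine p : size (p \Po aff) = size p.
Proof. exact/size_comp_poly2/size_affine. Qed.

(** Multiplying by p and then substituting is substituting and then multiplying
    by the substituted p. *)
Lemma band_comp n d (p : {poly R}) : (n + size p <= d.+1)%N ->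
  (lin1_mx (poly_rV \o p \o* rVpoly) : 'M_(n, d)) *m comp_mx d =
  comp_mx n *m lin1_mx (poly_rV \o (p \Po aff) \o* rVpoly).
Proof.
move=> sp; apply/row_matrixP => i.
rewrite !rowE !mulmxA !mul_rV_lin1 /=; set u := rVpoly (delta_mx 0 i).
have su : (size u <= n)%N by exact: size_poly.
rewrite !poly_rV_K ?comp_polyM ?size_comp_affine //.
apply: leq_trans (size_polyMleq _ _) _.
rewrite -subn1 leq_subLR add1n; apply: leq_trans sp.
by rewrite leq_add2r.
Qed.

(** The substitution acts on the columns of the Sylvester matrix by a triangular
    matrix of size n + m, and on its two blocks of rows by triangular matrices
    of sizes n and m.  The powers of a on the diagonals account for
    a^(1 + ... + (n + m - 1)) against a^(1 + ... + (n - 1)) a^(1 + ... + (m - 1)),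
    whose quotient is a^(m n). *)
Lemma det_sylv_comp m n (p q : {poly R}) :
  (size p <= m.+1)%N -> (size q <= n.+1)%N ->
  \det (sylv m n (p \Po aff) (q \Po aff)) = a ^+ (m * n) * \det (sylv m n p q).
Proof.
move=> sp sq.
have nz k : \prod_(i < k) a ^+ i != 0 by apply/prodf_neq0 => i _; rewrite expf_neq0.
have E : sylv m n p q *m comp_mx (n + m) =
    block_mx (comp_mx n) 0 0 (comp_mx m) *m sylv m n (p \Po aff) (q \Po aff).
  rewrite mul_col_mx mul_block_col !mul0mx addr0 add0r; congr col_mx.
    by apply: band_comp; rewrite -addnS leq_add2l.
  by apply: band_comp; rewrite addnC -addSn leq_add2r.
have := congr1 determinant E; rewrite !det_mulmx det_ublock !det_comp_mx.
rewrite big_split_ord /=.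
under [X in _ * (_ * X) = _]eq_bigr do rewrite exprD.
rewrite big_split /= prodr_const card_ord -exprM (mulnC n) => H.
apply: (mulfI (mulf_neq0 (nz n) (nz m))); rewrite -H.
by rewrite mulrC -!mulrA; congr (_ * _); rewrite mulrC -!mulrA; congr (_ * _); rewrite mulrC.
Qed.
End AffineSubstitution.

Lemma det_sylv_scale (R : comNzRingType) (m n : nat) (c d : R) (p q : {poly R}) :
  \det (sylv m n (c *: p) (d *: q)) = c ^+ n * d ^+ m * \det (sylv m n p q).
Proof.
have -> : sylv m n (c *: p) (d *: q) =
    block_mx c%:M 0 0 d%:M *m sylv m n p q.
  rewrite mul_block_col !mul0mx addr0 add0r !mul_scalar_mx; congr col_mx.
    by apply/matrixP => i j; rewrite !mxE /= -scalerAr coefZ.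
  by apply/matrixP => i j; rewrite !mxE /= -scalerAr coefZ.
by rewrite det_mulmx det_ublock !det_scalar.
Qed.

Lemma size_deriv_char (F : fieldType) (n : nat) (p : {poly F}) :
  n.+1%:R != 0 :> F -> size p = n.+2 -> size p^`() = n.+1.
Proof.
move=> nz_n sp; apply/eqP; rewrite eqn_leq; apply/andP; split.
  by rewrite -ltnS -sp lt_size_deriv // -size_poly_gt0 sp.
rewrite ltnNge; apply/negP => /leq_sizeP /(_ n (leqnn n)) /eqP.
rewrite coef_deriv -mulr_natr mulf_eq0 (negPf nz_n) orbF.
have : lead_coef p != 0 by rewrite lead_coef_eq0 -size_poly_gt0 sp.
by rewrite lead_coefE sp => /negPf->.
Qed.

(** The discriminant in degree d = n + 1 is homogeneous of degree 2 (d - 1) in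
    the coefficients and is multiplied by a^(d (d - 1)) under X |-> a X + b. *)
Lemma discr_affine (F : fieldType) (n : nat) (a b c : F) (p : {poly F}) :
  a != 0 -> c != 0 -> n.+1%:R != 0 :> F -> size p = n.+2 ->
  discr (c *: (p \Po (a *: 'X + b%:P))) =
    c ^+ (n.*2) * a ^+ (n.+1 * n) * discr p.
Proof.
move=> nz_a nz_c nz_n sp.
have sc : size (p \Po (a *: 'X + b%:P)) = n.+2 by rewrite size_comp_affine.
have sd := size_deriv_char nz_n sp.
have E : (c *: (p \Po (a *: 'X + b%:P)))^`() =
         (c * a) *: (p^`() \Po (a *: 'X + b%:P)).
  rewrite derivZ deriv_comp derivD derivZ derivX derivC addr0 alg_polyC.
  by rewrite mulrC mul_polyC scalerA.
rewrite /discr E size_scale // sc sp /=.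
rewrite lead_coefZ lead_coef_comp ?size_affine // sp lead_coef_affine //=.
rewrite (@resultant_sylv _ n.+1 n) ?size_scale ?size_comp_affine ?mulf_neq0 //.
rewrite (@resultant_sylv _ n.+1 n p) // det_sylv_scale det_sylv_comp ?sp ?sd //.
have nz_an : a ^+ n.+1 != 0 by rewrite expf_neq0.
have nz_l : lead_coef p != 0 by rewrite lead_coef_eq0 -size_poly_gt0 sp.
rewrite exprMn exprS -addnn exprD.
set s := (-1) ^+ _; set D := \det _; set l := lead_coef p in nz_l *.
set a1 := a ^+ n.+1 in nz_an *; set a2 := a ^+ (_ * n); set c1 := c ^+ n.
by field; rewrite nz_l nz_an nz_c.
Qed.

(** * Determinants over Z[w] by certified triangularization *)

Delimit Scope Z_scope with BZ.

(** Polynomials over Z are encoded by the lists of their coefficients, constant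
    term first and trailing zeros allowed, so that [vm_compute] can run on
    them; [Poly] decodes them. *)
Fixpoint padd (s t : seq Z) : seq Z :=
  match s, t with
  | x :: s', y :: t' => Z.add x y :: padd s' t'
  | [::], _ => t
  | _, [::] => s
  end.

Fixpoint pmul (s t : seq Z) : seq Z :=
  if s is x :: s' then padd (map (Z.mul x) t) (Z0 :: pmul s' t) else [::].

Definition pexp (s : seq Z) (n : nat) : seq Z := iter n (pmul s) [:: Z.one].

Definition pnull (s : seq Z) : bool := all (fun x => x == 0) s.

Lemma Poly_cons (x : Z) s : Poly (x :: s) = Poly s * 'X + x%:P.
Proof. by rewrite /= cons_poly_def. Qed.

Lemma Poly_padd s t : Poly (padd s t) = Poly s + Poly t.
Proof.
elim: s t => [|x s IH] [|y t]; rewrite ?[Poly [::]]/(0 : {poly Z}) ?add0r ?addr0 //.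
rewrite [padd _ _]/= !Poly_cons IH.
by rewrite -[Z.add x y]/(x + y) polyCD; ring.
Qed.

Lemma Poly_scale x s : Poly (map (Z.mul x) s) = x%:P * Poly s.
Proof.
elim: s => [|y s IH]; first by rewrite mulr0.
by rewrite [map _ _]/= !Poly_cons IH -[Z.mul x y]/(x * y) polyCM; ring.
Qed.

Lemma Poly_pmul s t : Poly (pmul s t) = Poly s * Poly t.
Proof.
elim: s => [|x s IH]; first by rewrite mul0r.
rewrite [pmul _ _]/= Poly_padd Poly_scale !Poly_cons IH.
by rewrite -[Z0]/(0 : Z) polyC0; ring.
Qed.

Lemma Poly_pexp s n : Poly (pexp s n) = Poly s ^+ n.
Proof.
elim: n => [|n IH]; last by rewrite exprS -IH -Poly_pmul.
by rewrite Poly_cons mul0r add0r.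
Qed.

Lemma pnullP s : reflect (Poly s = 0) (pnull s).
Proof.
elim: s => [|x s IH]; first by left.
rewrite Poly_cons [pnull _]/=; apply: (iffP andP) => [[/eqP-> /IH->]|E].
  by rewrite mul0r add0r.
have x0 : x = 0.
  have := congr1 (fun p : {poly Z} => p`_0) E.
  by rewrite coefD coefMX coefC coef0 add0r.
split; first by rewrite x0.
apply/IH; move/eqP: E.
by rewrite x0 polyC0 addr0 mulf_eq0 polyX_eq0 orbF => /eqP.
Qed.

(** A matrix is a list of rows; entries left out are zero, which is why the
    Sylvester rows below need not be padded on the right. *)
Definition entry (M : seq (seq (seq Z))) (i j : nat) := nth [::] (nth [::] M i) j.

Definition list_mx n M : 'M[{poly Z}]_n := \matrix_(i, j) Poly (entry M i j).

Definition prod_entry n N M (i j : nat) : seq Z :=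
  foldr padd [::] [seq pmul (entry N i k) (entry M k j) | k <- iota 0 n].

Definition diag_prod n (e : nat -> nat -> seq Z) : seq Z :=
  foldr pmul [:: Z.one] [seq e i i | i <- iota 0 n].

Definition is_det_certificate n M N (d : seq Z) : bool :=
  let c := diag_prod n (entry N) in
  [&& all (fun i => all (fun j => pnull (entry N i j)) (iota i.+1 (n - i.+1)))
        (iota 0 n),
      all (fun i => all (fun j => pnull (prod_entry n N M i j)) (iota 0 i))
        (iota 0 n),
      ~~ pnull c &
      pnull (padd (pmul c d)
               (map Z.opp (diag_prod n (prod_entry n N M))))].

Lemma Poly_diag_prod n e : Poly (diag_prod n e) = \prod_(i < n) Poly (e i i).
Proof.
rewrite -(big_mkord predT (fun i => Poly (e i i))) /index_iota subn0 /diag_prod.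
elim: (iota 0 n) => [|i s IH]; last by rewrite big_cons -IH -Poly_pmul.
by rewrite big_nil Poly_cons mul0r add0r.
Qed.

Lemma list_mx_mul n N M :
  list_mx n N *m list_mx n M = \matrix_(i, j) Poly (prod_entry n N M i j).
Proof.
apply/matrixP => i j; rewrite !mxE; under eq_bigr do rewrite !mxE.
rewrite -(big_mkord predT (fun k => Poly (entry N i k) * Poly (entry M k j))).
rewrite /index_iota subn0 /prod_entry.
elim: (iota 0 n) => [|k s IH]; last by rewrite big_cons IH /= Poly_padd Poly_pmul.
by rewrite big_nil.
Qed.

(** det N det M = det (N M), where the outer two determinants are products of
    diagonal entries, and det N can be cancelled in the domain Z[w]. *)
Lemma det_certificate n M N d :
  is_det_certificate n M N d -> \det (list_mx n M) = Poly d.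
Proof.
case/and4P=> /allP triN /allP triT nz_c /pnullP eq_d.
have detN : \det (list_mx n N) = Poly (diag_prod n (entry N)).
  rewrite Poly_diag_prod det_trig.
    by apply: eq_bigr => i _; rewrite mxE.
  apply/is_trig_mxP => i j lt_ij; rewrite mxE; apply/pnullP.
  have /triN/allP : (i : nat) \in iota 0 n by rewrite mem_iota ltn_ord.
  by apply; rewrite mem_iota subnKC // ltn_ord lt_ij.
have detT : \det (list_mx n N *m list_mx n M) =
    Poly (diag_prod n (prod_entry n N M)).
  rewrite list_mx_mul Poly_diag_prod -det_tr det_trig.
    by apply: eq_bigr => i _; rewrite !mxE.
  apply/is_trig_mxP => i j lt_ij; rewrite !mxE; apply/pnullP.
  have /triT/allP : (j : nat) \in iota 0 n by rewrite mem_iota ltn_ord.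
  by apply; rewrite mem_iota.
have nz : Poly (diag_prod n (entry N)) != 0 by apply/eqP => /pnullP; apply/negP.
apply: (mulfI nz); rewrite -{1}detN -det_mulmx detT; apply/eqP.
have Poly_opp s : Poly (map Z.opp s) = - Poly s.
  elim: s => [|y u IH]; first by rewrite oppr0.
  by rewrite [map _ _]/= !Poly_cons IH -[Z.opp y]/(- y) polyCN; ring.
by rewrite -subr_eq0 -oppr_eq0 opprB -Poly_opp -Poly_pmul -Poly_padd eq_d.
Qed.

(** Quotient of s by t when it is exact, computed from the lowest coefficients
    as for power series.  Nothing is proved about this function nor about the
    elimination below: they only serve to produce a certificate. *)
Fixpoint pdiv_exact (fuel : nat) (s t : seq Z) : seq Z :=
  match fuel, s, t with
  | k.+1, x :: s', y :: t' =>
    if Z.eqb y Z.zero then pdiv_exact k s' t'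
    else let q := Z.div x y in
         q :: pdiv_exact k (padd s' (map (Z.mul (Z.opp q)) (take (size s') t'))) t
  | _, _, _ => [::]
  end.

Definition ptrim (s : seq Z) : seq Z :=
  foldr (fun x t => if Z.eqb x Z.zero && nilp t then [::] else x :: t) [::] s.

(** Fraction-free elimination.  By Sylvester's identity the entries computed at
    step k are minors of the initial matrix, divisible by the previous pivot
    [prev]; dividing keeps the degrees linear in k. *)
Fixpoint bareiss (fuel k : nat) (prev : seq Z) (rows : seq (seq (seq Z))) :=
  match fuel, rows with
  | f.+1, r :: rs =>
    let p := nth [::] r k in
    let reduce r' :=
      let c := map Z.opp (nth [::] r' k) in
      [seq let s := padd (pmul p xy.2) (pmul c xy.1) in
           ptrim (pdiv_exact (size s + size prev) s prev) | xy <- zip r r'] in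
    r :: bareiss f k.+1 p (map reduce rs)
  | _, _ => [::]
  end.

(** Eliminating in M augmented by the identity matrix leaves in the right half
    the row operations performed. *)
Definition triangularizer n M : seq (seq (seq Z)) :=
  map (drop n) (bareiss n 0 [:: Z.one]
    [seq [seq entry M i k | k <- iota 0 n] ++
         [seq (if k == i then [:: Z.one] else [::]) | k <- iota 0 n]
      | i <- iota 0 n]).

Definition sylv_rows (m n : nat) (p q : seq (seq Z)) : seq (seq (seq Z)) :=
  [seq nseq i [::] ++ p | i <- iota 0 n] ++ [seq nseq i [::] ++ q | i <- iota 0 m].

Definition deriv_rows (p : seq (seq Z)) : seq (seq Z) :=
  [seq map (Z.mul (Z.of_nat i.+1)) (nth [::] p i.+1) | i <- iota 0 (size p).-1].

Lemma coef_rows (s : seq (seq Z)) k :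
  (Poly [seq Poly t | t <- s] : {poly {poly Z}})`_k = Poly (nth [::] s k).
Proof.
rewrite coef_Poly; have [lt_k|ge_k] := ltnP k (size s); first exact: nth_map.
by rewrite !nth_default ?size_map.
Qed.

Lemma list_mx_sylv m n (p q : seq (seq Z)) :
  list_mx (n + m) (sylv_rows m n p q) =
  sylv m n (Poly [seq Poly s | s <- p]) (Poly [seq Poly s | s <- q]).
Proof.
have shiftE s k i : Poly (nth [::] (nseq i [::] ++ s) k) =
    (Poly (nth [::] s (k - i)) : {poly Z}) *+ (i <= k)%N.
  by rewrite nth_cat size_nseq nth_nseq; case: ltnP => _.
apply/matrixP => i j; rewrite sylvE mxE /entry /sylv_rows nth_cat !coef_rows.
rewrite size_map size_iota; case: ltnP => [lt_in|ge_in].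
  by rewrite (nth_map 0%N) ?size_iota // nth_iota ?shiftE.
have lt_m : (i - n < m)%N by rewrite ltn_subLR.
by rewrite (nth_map 0%N) ?size_iota // nth_iota ?shiftE.
Qed.

Lemma Poly_deriv_rows (p : seq (seq Z)) :
  Poly [seq Poly s | s <- deriv_rows p] =
  (Poly [seq Poly s | s <- p])^`() :> {poly {poly Z}}.
Proof.
apply/polyP => i; rewrite coef_deriv !coef_rows /deriv_rows.
have [lt_i|ge_i] := ltnP i (size p).-1; last first.
  rewrite !nth_default ?size_map ?size_iota ?mul0rn //.
  by move: ge_i; case: (size p).
rewrite (nth_map 0%N) ?size_iota // nth_iota // Poly_scale.
have -> : Z.of_nat i.+1 = i.+1%:R by rewrite -{1}[i.+1]natn rmorph_nat.
by rewrite rmorph_nat mulr_natl.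
Qed.

(** * A sextic with discriminant a monomial in w and w - 1 *)

Definition sextic_rows : seq (seq Z) := [:: [:: -5]; [:: 18; 12]; [:: 0; -75];
  [:: 0; 20; 80]; [:: 0; 0; -15; -60]; [:: 0; 0; -30; 60];
  [:: 0; 0; 16; -25; 4]]%BZ.

(** 2^22 3^12 5^5 w^8 (w - 1)^15 times the leading coefficient of the sextic. *)
Definition sextic_resultant : seq Z :=
  pmul (pmul (pmul (pexp [:: 2%BZ] 22) (pexp [:: 3%BZ] 12)) (pexp [:: 5%BZ] 5))
    (pmul (pmul (pexp [:: 0; 1]%BZ 8) (pexp [:: -1; 1]%BZ 15))
       [:: 0; 0; 16; -25; 4]%BZ).

Lemma sextic_certificate :
  let S := sylv_rows 6 5 sextic_rows (deriv_rows sextic_rows) in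
  is_det_certificate 11 S (triangularizer 11 S) sextic_resultant.
Proof. by vm_compute. Qed.

Section Specialization.
Variables (R : comNzRingType) (w : R).

(** Specialization of the indeterminate of Z[w] at an element w of R. *)
Definition eval_list : {poly Z} -> R := horner_eval w \o map_poly (intr \o int_of_Z).
HB.instance Definition _ := GRing.RMorphism.on eval_list.

Lemma eval_list_nil : eval_list (Poly [::]) = 0.
Proof. exact: rmorph0. Qed.

Lemma eval_list_cons x s :
  eval_list (Poly (x :: s)) = (int_of_Z x)%:~R + w * eval_list (Poly s).
Proof.
rewrite Poly_cons rmorphD rmorphM /= addrC mulrC.
by rewrite /eval_list /= /horner_eval map_polyX map_polyC hornerX hornerC.
Qed.

Lemma map_eval_list_Poly (s : seq (seq Z)) :
  map_poly eval_list (Poly [seq Poly t | t <- s]) = Poly [seq eval_list (Poly t) | t <- s].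
Proof.
apply/polyP => i; rewrite coef_map !coef_Poly.
have [lt_i|ge_i] := ltnP i (size s).
  by rewrite !(nth_map [::]) ?size_map // (nth_map 0) ?size_map // (nth_map [::]).
by rewrite !nth_default ?size_map //; exact: rmorph0.
Qed.

(** The polynomial G with f(r X) = 400 j^2 G(X); it depends on j only through
    w, because all the terms of f are of the form c j^(2 - 2 i + 5 k) X^i. *)
Definition sextic : {poly R} := Poly [:: -5; 18 + 12 * w; - 75 * w; 20 * w + 80 * w ^+ 2;
  - 15 * w ^+ 2 - 60 * w ^+ 3; - 30 * w ^+ 2 + 60 * w ^+ 3;
  16 * w ^+ 2 - 25 * w ^+ 3 + 4 * w ^+ 4].

Lemma sextic_eval_list : map_poly eval_list (Poly [seq Poly t | t <- sextic_rows]) = sextic.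
Proof.
rewrite map_eval_list_Poly; congr Poly.
rewrite /sextic_rows !map_cons !(eval_list_cons, eval_list_nil).
by repeat (congr (_ :: _); first by ring).
Qed.

(** The identity holds in Z[w] by computation, hence for every w in every ring. *)
Lemma det_sylv_sextic :
  \det (sylv 6 5 sextic sextic^`()) =
  (2 ^+ 22 * 3 ^+ 12 * 5 ^+ 5) * w ^+ 8 * (w - 1) ^+ 15 *
    (16 * w ^+ 2 - 25 * w ^+ 3 + 4 * w ^+ 4).
Proof.
rewrite -sextic_eval_list deriv_map -Poly_deriv_rows.
have map_sylv p q : map_mx eval_list (sylv 6 5 p q) =
    sylv 6 5 (map_poly eval_list p) (map_poly eval_list q).
  by apply/matrixP => i j; rewrite mxE !sylvE !coef_map; case: ifP => _; rewrite rmorphMn.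
have E : \det (list_mx (5 + 6) (sylv_rows 6 5 sextic_rows (deriv_rows sextic_rows)))
    = Poly sextic_resultant.
  exact: (det_certificate sextic_certificate).
transitivity (eval_list (Poly sextic_resultant)).
  by rewrite -map_sylv -list_mx_sylv det_map_mx E.
have -> : Poly sextic_resultant =
    Poly [:: 2%BZ] ^+ 22 * Poly [:: 3%BZ] ^+ 12 * Poly [:: 5%BZ] ^+ 5 *
    (Poly [:: 0%BZ; 1%BZ] ^+ 8 * Poly [:: (-1)%BZ; 1%BZ] ^+ 15 *
     Poly [:: 0%BZ; 0%BZ; 16%BZ; (-25)%BZ; 4%BZ]).
  by rewrite -!Poly_pexp -!Poly_pmul.
(* Exponents kept abstract, so that the powers are not unfolded to products. *)
have specE a b c d e f k l m n o :
    eval_list (a ^+ k * b ^+ l * c ^+ m * (d ^+ n * e ^+ o * f)) =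
    eval_list a ^+ k * eval_list b ^+ l * eval_list c ^+ m *
      (eval_list d ^+ n * eval_list e ^+ o * eval_list f).
  by rewrite !rmorphM !rmorphXn.
rewrite specE !(eval_list_cons, eval_list_nil).
by ring.
Qed.
End Specialization.

Lemma discr_sextic (F : fieldType) (w : F) :
  6 != 0 :> F -> (sextic w)`_6 != 0 ->
  size (sextic w) = 7 /\
  discr (sextic w) = - (2 ^+ 22 * 3 ^+ 12 * 5 ^+ 5) * w ^+ 8 * (w - 1) ^+ 15.
Proof.
move=> nz6 nz_lead.
have sz : size (sextic w) = 7.
  apply/eqP; rewrite eqn_leq size_Poly /=.
  by rewrite ltnNge; apply: contra nz_lead => /leq_sizeP->.
split=> //; rewrite /discr lead_coefE sz /=.
rewrite (@resultant_sylv _ 6 5) ?(@size_deriv_char F 5) // det_sylv_sextic.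
move: nz_lead; rewrite coef_Poly /= => nz_lead.
rewrite [in X in (-1) ^+ X](_ : 'C(6, 2) = 15) // -signr_odd /= expr1.
by rewrite mulN1r mulNr mulfK // !mulNr.
Qed.

(** * The family in terms of the sextic *)

(** With c X in place of Z, this is G(1 + Z): the exponents 3, 3, 2, 2, 1, 1, 0
    of w - 1 are the halves of 6, 5, ..., 0, rounded up.  They are what makes
    the curve acquire good reduction over an extension where w - 1 becomes a
    square up to a unit. *)
Lemma sextic_comp_shift (R : comNzRingType) (w c : R) :
  sextic w \Po (c *: 'X + 1%:P) = Poly [::
   (w - 1) ^+ 3 * (4 * w - 13);
   c * ((w - 1) ^+ 3 * (24 * w - 18));
   c ^+ 2 * ((w - 1) ^+ 2 * (60 * w ^+ 2 - 15 * w));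
   c ^+ 3 * ((w - 1) ^+ 2 * (80 * w ^+ 2 + 20 * w));
   c ^+ 4 * ((w - 1) * (60 * w ^+ 3 - 75 * w ^+ 2));
   c ^+ 5 * ((w - 1) * (24 * w ^+ 3 - 66 * w ^+ 2));
   c ^+ 6 * (16 * w ^+ 2 - 25 * w ^+ 3 + 4 * w ^+ 4)].
Proof.
rewrite /sextic /= !cons_poly_def !comp_poly_MXaddC comp_poly0 -!mul_polyC.
ring.
Qed.

Lemma sextic_comp_scale (R : comNzRingType) (w c : R) :
  sextic w \Po (c *: 'X + 0%:P) = Poly [:: -5; c * (18 + 12 * w); c ^+ 2 * (- 75 * w);
  c ^+ 3 * (20 * w + 80 * w ^+ 2); c ^+ 4 * (- 15 * w ^+ 2 - 60 * w ^+ 3);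
  c ^+ 5 * (- 30 * w ^+ 2 + 60 * w ^+ 3);
  c ^+ 6 * (16 * w ^+ 2 - 25 * w ^+ 3 + 4 * w ^+ 4)].
Proof.
rewrite /sextic /= !cons_poly_def !comp_poly_MXaddC comp_poly0 -!mul_polyC.
ring.
Qed.

(** The polynomial P of E_j over an arbitrary field.  In rat large numerals
    compute, in an abstract field they do not; identities about the coefficients
    are thus proved in an abstract field and then specialized. *)
Definition family_P (F : fieldType) (j : F) : {poly F} :=
  (4096 * 10 ^+ 10 - 1458 * 10 ^+ 7 * j ^+ 5 + 3 ^+ 12 * j ^+ 10) *: 'X^6
  - (864 * 10 ^+ 8 * j ^+ 2 - 2 * 3 ^+ 9 * 10 ^+ 3 * j ^+ 7) *: 'X^5
  - (1 / 4 + 486 * 10 ^+ 5 * j ^+ 4 + 3 ^+ 11 * j ^+ 9 / 4) *: 'X^4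
  + (32 * 10 ^+ 7 * j + 2916 * 10 ^+ 2 * j ^+ 6) *: 'X^3
  - (135 * 10 ^+ 4 * j ^+ 3) *: 'X^2
  + (16 * 10 ^+ 5 + 243 * j ^+ 5) *: 'X
  - (500 * j ^+ 2)%:P.

Definition param_w (F : fieldType) (j : F) : F := 729 * j ^+ 5 / (32 * 10 ^+ 5).
(** The sixfold root of f modulo A. *)
Definition param_r (F : fieldType) (j : F) : F := 9 * j ^+ 2 / (8 * 10 ^+ 3).

Definition radic (F : fieldType) (j : F) : F := - (32 * 10 ^+ 5) + 729 * j ^+ 5.

Definition scaled_sextic (F : fieldType) (j : F) : {poly F} :=
  (400 * j ^+ 2) *: (sextic (param_w j) \Po ((param_r j)^-1 *: 'X + 0%:P)).

Lemma family_sextic_coefs (F : numFieldType) (j : F) : j != 0 ->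
  4 *: family_P j + (- 'X^2) ^+ 2 =
  scaled_sextic j :> {poly F}.
Proof.
move=> nz_j; rewrite /scaled_sextic sextic_comp_scale /family_P.
have -> : (param_r j)^-1 = 8 * 10 ^+ 3 / (9 * j ^+ 2) by rewrite /param_r invf_div.
rewrite /param_w; apply/polyP => i.
rewrite coefZ coef_Poly sqrrN -exprM !(coefD, coefN, coefB, coefZ, coefXn, coefX, coefC).
do 7![case: i => [|i]; first by
  rewrite [nth _ _ _]/= /= ?(mulr0, mulr1, addr0, add0r, subr0, sub0r, oppr0); field].
by rewrite /= nth_nil !(mulr0, addr0, subr0).
Qed.

Lemma family_sextic (j : rat) : j != 0 ->
  4 *: wP (E j) + wQ (E j) ^+ 2 =
  scaled_sextic j.
Proof. exact: family_sextic_coefs. Qed.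

(** The factor (400 j^2)^10 r^-30 is what [discr_affine] gives for the passage
    from G to f. *)
Lemma disc_identity (F : numFieldType) (j : F) : j != 0 ->
  2 ^- 12 * ((400 * j ^+ 2) ^+ 10 * (param_r j)^-1 ^+ 30 *
    (- (2 ^+ 22 * 3 ^+ 12 * 5 ^+ 5) * param_w j ^+ 8 * (param_w j - 1) ^+ 15)) =
  - radic j ^+ 15.
Proof.
move=> nz_j.
have -> : param_w j - 1 = radic j / (32 * 10 ^+ 5).
  by rewrite /param_w /radic; field.
move: (radic j) => A; rewrite /param_w /param_r.
by field.
Qed.

Lemma disc6_scaled_sextic (F : numFieldType) (j : F)
    (f := scaled_sextic j) :
  j != 0 -> f`_6 != 0 ->
  size f = 7 /\ 2 ^- 12 * disc6 f = - radic j ^+ 15.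
Proof.
move=> nz_j nz6; rewrite /disc6 nz6 -disc_identity //; move: nz6; rewrite /f /scaled_sextic.
have nz_r : (param_r j)^-1 != 0.
  by rewrite invr_eq0 mulf_neq0 ?invr_eq0 ?mulf_neq0 ?expf_neq0 ?pnatr_eq0.
have nz_k : 400 * j ^+ 2 != 0 by rewrite mulf_neq0 ?expf_neq0 ?pnatr_eq0.
set w := param_w j; set r := (param_r j)^-1 in nz_r *.
set k := 400 * j ^+ 2 in nz_k *.
move=> nz6.
have {}nz6 : (sextic w)`_6 != 0.
  apply: contra nz6 => /eqP; rewrite coefZ sextic_comp_scale !coef_Poly /= => ->.
  by rewrite !mulr0.
have [|sz disc] := @discr_sextic _ w _ nz6; first by rewrite pnatr_eq0.
split; first by rewrite size_scale // size_comp_affine.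
rewrite (@discr_affine _ 5) ?pnatr_eq0 // disc.
by [].
Qed.

Lemma wdisc_family (j : rat) : j != 0 ->
  (4 *: wP (E j) + wQ (E j) ^+ 2)`_6 != 0 ->
  size (4 *: wP (E j) + wQ (E j) ^+ 2) = 7 /\ wdisc (E j) = - radicand j ^+ 15.
Proof.
move=> nz_j; rewrite /wdisc (family_sextic nz_j).
exact: disc6_scaled_sextic.
Qed.

(** * Integrality at j = 20 t - 3 *)

Section IntegerParameter.
Variables (F : numFieldType) (t : int).
Local Notation j := ((20 * t - 3)%:~R : F).

Definition is_integer (x : F) := exists m : int, x = m%:~R.

Lemma is_integer_intr m : is_integer m%:~R.
Proof. by exists m. Qed.

Lemma is_integer_nat n : is_integer n%:R.
Proof. by exists n. Qed.

Lemma is_integerD x y : is_integer x -> is_integer y -> is_integer (x + y).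
Proof. by move=> [m ->] [n ->]; exists (m + n); rewrite intrD. Qed.

Lemma is_integerN x : is_integer x -> is_integer (- x).
Proof. by move=> [m ->]; exists (- m); rewrite mulrNz. Qed.

Lemma is_integerM x y : is_integer x -> is_integer y -> is_integer (x * y).
Proof. by move=> [m ->] [n ->]; exists (m * n); rewrite intrM. Qed.

Lemma is_integerX x n : is_integer x -> is_integer (x ^+ n).
Proof. by move=> [m ->]; exists (m ^+ n); rewrite rmorphXn. Qed.

Local Ltac integrality :=
  lazymatch goal with
  | |- is_integer (_ + _) => apply: is_integerD; integrality
  | |- is_integer (- _) => apply: is_integerN; integrality
  | |- is_integer (_ * _) => assumption || (apply: is_integerM; integrality)
  | |- is_integer (_ ^+ _) => apply: is_integerX; integrality
  | |- is_integer (_%:~R) => apply: is_integer_intr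
  | |- is_integer (_%:R) => apply: is_integer_nat
  | |- is_integer 0 => exact: (is_integer_nat 0)
  | |- is_integer 1 => exact: (is_integer_nat 1)
  | |- _ => try assumption
  end.

(** Being an odd integer is expressed by (x - 1) / 2 being an integer. *)
Lemma odd_is_integer (x : F) : is_integer ((x - 1) / 2) -> is_integer x.
Proof.
move=> h; have -> : x = (x - 1) / 2 * 2 + 1 by field.
by integrality.
Qed.

Lemma odd_integerM (x y : F) : is_integer ((x - 1) / 2) -> is_integer ((y - 1) / 2) ->
  is_integer ((x * y - 1) / 2).
Proof.
move=> ox oy; have -> : (x * y - 1) / 2 = x * ((y - 1) / 2) + (x - 1) / 2 by field.
by have := odd_is_integer ox; move=> *; integrality.
Qed.

Lemma odd_integerX (x : F) n : is_integer ((x - 1) / 2) -> is_integer ((x ^+ n - 1) / 2).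
Proof.
move=> ox; elim: n => [|n IH]; first by rewrite expr0 subrr mul0r; integrality.
by rewrite exprS; apply: odd_integerM.
Qed.

Lemma odd_integer_neq0 (x : F) : is_integer ((x - 1) / 2) -> x != 0.
Proof.
move=> [m hm]; apply/eqP => x0; move: hm; rewrite x0 => hm.
have : (2 * m + 1)%:~R = 0 :> F by rewrite intrD intrM -hm; field.
by move/eqP; rewrite intr_eq0 => /eqP; lia.
Qed.

Lemma parameter_odd : is_integer ((j - 1) / 2).
Proof.
have -> : (j - 1) / 2 = (10 * t - 2)%:~R.
  by rewrite !rmorphB !rmorphM /=; field.
exact: is_integer_intr.
Qed.

Lemma parameter_neq0 : j != 0.
Proof. exact/odd_integer_neq0/parameter_odd. Qed.

(** The leading coefficient of P is an odd integer, because j is odd and the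
    other two terms are even. *)
Lemma coef6_odd_neq0 :
  4096 * 10 ^+ 10 - 1458 * 10 ^+ 7 * j ^+ 5 + 3 ^+ 12 * j ^+ 10 != 0.
Proof.
apply: odd_integer_neq0; set x := j.
have -> : (4096 * 10 ^+ 10 - 1458 * 10 ^+ 7 * x ^+ 5 + 3 ^+ 12 * x ^+ 10 - 1) / 2 =
  2048 * 10 ^+ 10 - 729 * 10 ^+ 7 * x ^+ 5 + (3 ^+ 12 * x ^+ 10 - 1) / 2 by field.
have ox : is_integer ((x - 1) / 2) by exact: parameter_odd.
have : is_integer ((3 ^+ 12 * x ^+ 10 - 1) / 2).
  apply: odd_integerM; last exact: odd_integerX.
  by apply: odd_integerX; have -> : (3 - 1) / 2 = 1 :> F; [field | integrality].
by have := odd_is_integer ox; move=> *; integrality.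
Qed.

(** Modulo 20, 3200000 is 0 and 729 j^5 is 9 (-3)^5 = - 2187, which is 13. *)
Lemma radic_mod20 : exists m : int, radic j = (20 * m + 13)%:~R.
Proof.
have [m hm] : is_integer ((radic j - 13) / 20).
  have -> : (radic j - 13) / 20 =
    - (16 * 10 ^+ 4) + 729 * (16 * 10 ^+ 4 * t%:~R ^+ 5 - 12 * 10 ^+ 4 * t%:~R ^+ 4
     + 36 * 10 ^+ 3 * t%:~R ^+ 3 - 54 * 10 ^+ 2 * t%:~R ^+ 2 + 405 * t%:~R)
    - 8858 :> F.
    by rewrite /radic rmorphB rmorphM /=; field.
  by integrality.
exists m; move: (radic j) hm => A hm.
by rewrite intrD intrM -hm; field.
Qed.

(** With j = 4 k + 1 and k = 5 t - 1, 1 + 3^11 j^9 is (1 + 3^11) + 3^11 (j^9 - 1)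
    where 1 + 3^11 = 4 * 67 * 661 and j^9 - 1 = 4 k (j^8 + ... + 1). *)
Lemma family_coef4_integer :
  is_integer (1 / 4 + 486 * 10 ^+ 5 * j ^+ 4 + 3 ^+ 11 * j ^+ 9 / 4).
Proof.
have -> : 1 / 4 + 486 * 10 ^+ 5 * j ^+ 4 + 3 ^+ 11 * j ^+ 9 / 4 =
  486 * 10 ^+ 5 * j ^+ 4 + 67 * 661 + 3 ^+ 11 * ((5 * t%:~R - 1) *
    (j ^+ 8 + j ^+ 7 + j ^+ 6 + j ^+ 5 + j ^+ 4 + j ^+ 3 + j ^+ 2 + j + 1)).
  by rewrite rmorphB rmorphM /=; field.
by integrality.
Qed.

Lemma family_P_integer i : is_integer (family_P j)`_i.
Proof.
have h4 := family_coef4_integer.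
rewrite /family_P !(coefD, coefN, coefB, coefZ, coefXn, coefX, coefC).
move: h4; set c4 := 1 / 4 + _ + _; move: (parameter_odd) => /odd_is_integer.
move: j c4 => x c4 hx h4.
by integrality; case: ifP => _; integrality.
Qed.
Lemma family_Q_integer i : is_integer ((- 'X^2 : {poly F})`_i).
Proof. by rewrite coefN coefXn; apply: is_integerN; case: eqP => _; integrality. Qed.

Lemma family_coef6_neq0 : (4 *: family_P j + (- 'X^2) ^+ 2)`_6 != 0.
Proof.
rewrite /family_P sqrrN -exprM !(coefD, coefN, coefB, coefZ, coefXn, coefX, coefC) /=.
by rewrite !(mulr0, mulr1, addr0, subr0) mulf_neq0 ?coef6_odd_neq0 // pnatr_eq0.
Qed.
End IntegerParameter.

Lemma family_facts (t : int) (W := E (jt t)) :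
  [/\ size (4 *: wP W + wQ W ^+ 2) = 7,
      wdisc W = - radicand (jt t) ^+ 15,
      (forall i, is_integer (wP W)`_i),
      (forall i, is_integer (wQ W)`_i)
    & exists m : int, radicand (jt t) = (20 * m + 13)%:~R].
Proof.
have nz_j : jt t != 0 := parameter_neq0 rat t.
have [sz disc] := wdisc_family nz_j (family_coef6_neq0 rat t).
have rad : exists m : int, radicand (jt t) = (20 * m + 13)%:~R := radic_mod20 rat t.
exact: And5 sz disc (family_P_integer rat t) (family_Q_integer rat) rad.
Qed.

(** * Function fields *)

(** L is K[Y] / (Y^2 - d), a field since a quadratic polynomial without roots
    is irreducible. *)
Lemma quadratic_extension (K : fieldType) (d : K) :
  (forall a, a ^+ 2 != d) ->
  exists (L : fieldType) (tau : {rmorphism K -> L}) (Y : L),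
    Y ^+ 2 = tau d /\ forall z : L, exists a b, z = tau a + tau b * Y.
Proof.
move=> nsq; pose h : {poly K} := 'X^2 - d%:P.
have sz_h : size h = 3.
  by rewrite size_polyDl ?size_polyXn // size_polyN size_polyC; case: eqP.
have mon_h : h \is monic.
  rewrite monicE lead_coefDl ?lead_coefXn // size_polyN size_polyC size_polyXn.
  by case: eqP.
have irr_h : monic_irreducible_poly h.
  split=> //; apply: cubic_irreducible; first by rewrite sz_h.
  by move=> x; rewrite /root !hornerE subr_eq0 nsq.
pose L : fieldType := {poly %/ h with irr_h}.
have hE : mk_monic h = h by rewrite mk_monicE.
pose q : {rmorphism {poly K} -> L} := in_qpoly h.
pose tau : {rmorphism K -> L} := q \o polyC.
exists L, tau, (q 'X); split.
  apply/eqP; rewrite -subr_eq0 /tau /= -rmorphXn -rmorphB -/h /=.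
  have : in_qpoly h h = 0.
    apply/val_eqP => /=; rewrite -[X in Pdiv.Ring.rmodp X]hE.
    by rewrite Pdiv.RingMonic.rmodpp // monic_mk_monic.
  by move=> e; apply/eqP.
move=> z; pose p : {poly K} := val z.
have sp : (size p <= 2)%N by rewrite -ltnS (leq_trans (size_mk_monic z)) // hE sz_h.
have zE : z = q p.
  have E : in_qpoly h (val z) = z :> {poly %/ h}.
    by apply/val_eqP/eqP => /=; apply/Pdiv.Ring.rmodp_small/size_mk_monic.
  by rewrite -[LHS]E.
exists p`_0, p`_1; rewrite zE /tau /= -rmorphM -rmorphD /=.
congr (in_qpoly h _); apply/polyP => i.
rewrite coefD coefMX !coefC.
case: i => [|[|i]] /=; rewrite ?addr0 ?add0r ?coefC //.
by rewrite nth_default // (leq_trans sp).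
Qed.

Lemma fraction_quotient (R : idomainType) (a : {fraction R}) :
  exists p q : R, q != 0 /\ a = FracField.tofrac p / FracField.tofrac q.
Proof.
elim/quotW: a => r; exists (frac r).1, (frac r).2; split; first exact: denom_ratioP.
set d := (frac r).2; set n := (frac r).1.
have nz : FracField.tofrac d != 0 by rewrite tofrac_eq0; apply: denom_ratioP.
apply: (mulIf nz); rewrite divfK //.
rewrite /GRing.mul /= !piE; apply/eqP; rewrite FracField.equivf_def.
rewrite /FracField.mulf !numden_Ratio ?mulr1 ?mul1r ?denom_ratioP ?oner_neq0 //.
  by rewrite mulrC.
Qed.

Lemma evalp_morph (F L : fieldType) (r : {rmorphism {poly F} -> L}) (p : {poly F}) :
  evalp (r \o polyC) (r 'X) p = r p.
Proof.
by rewrite /evalp map_poly_comp horner_map -[X in _ = r X]comp_polyXr.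
Qed.

(** A square u^2 shares the factor u with its derivative, and f k^2 can only be
    a square if f is one. *)
Lemma coprime_deriv_not_square (F : fieldType) (f h k : {poly F}) :
  coprimep f f^`() -> (1 < size f)%N -> k != 0 -> h ^+ 2 != f * k ^+ 2.
Proof.
move=> cop sz nz_k; apply/eqP => e.
have /dvdpP[u hE] : k %| h.
  by rewrite -(dvdp_pexp2r k h (isT : 0 < 2)%N) e dvdp_mulIr.
have fE : f = u * u.
  by apply: (mulIf (expf_neq0 2 nz_k)); rewrite -e hE exprMn.
have u1 : u %= 1.
  apply: (coprimepP _ _ cop); rewrite fE ?dvdp_mulIr //.
  by rewrite derivM dvdp_add ?dvdp_mulIl ?dvdp_mulIr.
move: sz; rewrite fE (eqp_size (eqp_mulr u u1)) mul1r (eqp_size u1).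
by rewrite size_poly1.
Qed.

Section FunctionField.
Variables (F : fieldType) (W : weierstrass F).
Local Notation f := (4 *: wP W + wQ W ^+ 2).

(** Completing the square, the function field is F(x)(Y) with Y^2 = f and
    y = (Y - Q) / 2; f is not a square in F(x) because it is separable and not
    constant. *)
Lemma function_field_exists :
  2 != 0 :> F -> (size (wQ W) <= 4)%N -> (size (wP W) <= 7)%N ->
  coprimep f f^`() -> (1 < size f)%N ->
  exists (L : fieldType) (iota : {rmorphism F -> L}) (x y : L),
    function_field_of W iota x y.
Proof.
move=> nz2 sQ sP cop sf.
pose c : {rmorphism {poly F} -> {fraction {poly F}}} := @FracField.tofrac {poly F}.
have nsq (a : {fraction {poly F}}) : a ^+ 2 != c f.
  have [p [q [nz_q ->]]] := fraction_quotient a; apply/eqP => e.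
  have nz_cq : c q != 0 by rewrite tofrac_eq0.
  have := coprime_deriv_not_square p cop sf nz_q; rewrite -tofrac_eq => /eqP[].
  have clear_denom (A : fieldType) (u v w : A) :
      v != 0 -> (u / v) ^+ 2 = w -> u ^+ 2 = w * v ^+ 2.
    by move=> nz_v <-; rewrite expr_div_n divfK // expf_neq0.
  rewrite tofracXn tofracM tofracXn; exact: (clear_denom _ _ _ _ nz_cq e).
have [L [tau [Y [Y2 gen]]]] := quadratic_extension nsq.
pose r : {rmorphism {poly F} -> L} := tau \o c.
pose iota : {rmorphism F -> L} := r \o polyC.
have rE p : evalp iota (r 'X) p = r p by apply: evalp_morph.
have r0 p : r p = 0 -> p = 0.
  by move/eqP; rewrite fmorph_eq0 tofrac_eq0 => /eqP.
have nz2L : 2 != 0 :> L by rewrite -(rmorph_nat iota) fmorph_eq0.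
have nz4L : 4 != 0 :> L by rewrite (natrM _ 2 2) mulf_neq0.
exists L, iota, (r 'X), ((Y - r (wQ W)) / 2); split=> //.
- rewrite !rE; have {}Y2 : Y ^+ 2 = 4 * r (wP W) + r (wQ W) ^+ 2.
    by rewrite Y2 -[tau _]/(r f) scaler_nat rmorphD rmorphXn rmorphMn mulr_natl.
  rewrite (_ : r (wP W) = (Y ^+ 2 - r (wQ W) ^+ 2) / 4); first by field; rewrite nz2L nz4L.
  by rewrite Y2; field; rewrite nz4L.
- by move=> h; rewrite rE => /r0.
- move=> h k nz_k; rewrite !rE => e.
  have nz_ck : c k != 0 by rewrite tofrac_eq0; apply/eqP.
  have : Y = tau ((2 * c h + c (wQ W) * c k) / c k).
    rewrite fmorph_div rmorphD !rmorphM rmorph_nat /= -![tau (c _)]/(r _) -e.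
    have : r k != 0 by rewrite fmorph_eq0.
    by move=> nz_rk; field; rewrite ?nz_rk ?nz2L.
  move/(congr1 (fun z => z ^+ 2)); rewrite Y2 -rmorphXn => /fmorph_inj h2.
  by have := nsq ((2 * c h + c (wQ W) * c k) / c k); rewrite -h2 eqxx.
move=> z; have [a [b ->]] := gen z.
have [p [q [nz_q ->]]] := fraction_quotient a.
have [p' [q' [nz_q' ->]]] := fraction_quotient b.
exists (p * q' + p' * wQ W * q), (p' * q *+ 2), (q * q'); split.
  by apply/eqP; rewrite mulf_neq0.
have nz_r : r q != 0 by rewrite fmorph_eq0 tofrac_eq0.
have nz_r' : r q' != 0 by rewrite fmorph_eq0 tofrac_eq0.
rewrite !rE rmorphMn !(rmorphD, rmorphM) /=.
rewrite !fmorphV /= -![tau (FracField.tofrac _)]/(r _).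
by field; rewrite nz2L nz_r nz_r'.
Qed.
End FunctionField.

(** * Integral elements of a quadratic extension of F(x) *)

(** Evaluation at x is a ring morphism, so that the theory of integral elements
    applies to the rings of functions. *)
HB.instance Definition _ (F L : fieldType) (iota : {rmorphism F -> L}) (x : L) :=
  GRing.RMorphism.copy (evalp iota x) (horner_eval x \o map_poly iota).

Section Evaluation.
Variables (F L : fieldType) (iota : {rmorphism F -> L}) (x : L).
Local Notation e := (evalp iota x).
Hypothesis transc : forall h : {poly F}, e h = 0 -> h = 0.

Lemma evalpC c : e c%:P = iota c.
Proof. by rewrite /evalp map_polyC hornerC. Qed.

Lemma evalpX : e 'X = x.
Proof. by rewrite /evalp map_polyX hornerX. Qed.

Lemma evalp_eq0 h : (e h == 0) = (h == 0).
Proof. by apply/eqP/eqP => [/transc|->] //; rewrite rmorph0. Qed.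

Lemma evalp_inj : injective e.
Proof. by move=> p q /eqP; rewrite -subr_eq0 -rmorphB evalp_eq0 subr_eq0 => /eqP. Qed.

Lemma x_neq0 : x != 0.
Proof. by rewrite -evalpX evalp_eq0 polyX_eq0. Qed.

(** The rational root theorem for F[x]: if p1 / q1 in lowest terms is a root of
    a monic polynomial of degree n, then q1 divides p1^n, so q1 is constant.
    It is stated for an arbitrary transcendental x, in order to be applied to
    1 / x as well. *)
Lemma evalp_integrally_closed z p q :
  integralOver e z -> q != 0 -> z * e q = e p -> exists r, z = e r.
Proof.
move=> [M mon_M rootM] nz_q zq.
have nz_d : gcdp p q != 0 by rewrite gcdp_eq0 (negPf nz_q) andbF.
have /dvdpP[p1 pE] := dvdp_gcdl p q; have /dvdpP[q1 qE] := dvdp_gcdr p q.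
have nz_q1 : q1 != 0 by apply: contra nz_q => /eqP q10; rewrite qE q10 mul0r.
have zq1 : z * e q1 = e p1.
  apply: (mulIf (_ : e (gcdp p q) != 0)); first by rewrite evalp_eq0.
  by rewrite -mulrA -!rmorphM -pE -qE.
have cop : coprimep p1 q1.
  have -> : p1 = p %/ gcdp p q by rewrite {1}pE mulpK.
  have -> : q1 = q %/ gcdp p q by rewrite {1}qE mulpK.
  by rewrite coprimep_div_gcd // nz_q orbT.
pose n := (size M).-1.
have : e (\sum_(i < n.+1) M`_i * p1 ^+ i * q1 ^+ (n - i)) = 0.
  transitivity ((map_poly e M).[z] * e q1 ^+ n); last by rewrite (rootP rootM) mul0r.
  rewrite (@horner_coef_wide _ n.+1).
    rewrite raddf_sum big_distrl /=; apply: eq_bigr => i _.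
    rewrite coef_map !rmorphM !rmorphXn /= -zq1 exprMn -!mulrA.
    by rewrite -exprD subnKC // -ltnS.
  by rewrite (leq_trans (size_poly _ _)) // /n leqSpred.
move/transc; rewrite big_ord_recr /= subnn expr0 mulr1.
have -> : M`_n = 1 by have := monicP mon_M; rewrite lead_coefE.
rewrite mul1r => /eqP; rewrite addrC addr_eq0 => /eqP pn.
have : q1 %| p1 ^+ n.
  rewrite pn dvdpNr; apply: (big_ind (fun u => q1 %| u)) => [|u v|i _].
  - exact: dvdp0.
  - exact: dvdp_add.
  by rewrite dvdp_mull // -(subnSK (ltn_ord i)) exprS dvdp_mulIl.
rewrite -(mulr1 (p1 ^+ n)) Gauss_dvdpr; last first.
  by rewrite coprimep_expr // coprimep_sym.
rewrite dvdp1 => /size_poly1P[c nz_c q1E].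
exists (c^-1 *: p1); rewrite -mul_polyC rmorphM /= -zq1 q1E !evalpC.
by rewrite mulrCA -rmorphM mulVf // rmorph1 mulr1.
Qed.
End Evaluation.

Lemma integral_sqrt (R L : nzRingType) (rho : {rmorphism R -> L}) (z : L) (r : R) :
  z ^+ 2 = rho r -> integralOver rho z.
Proof.
move=> z2; exists ('X^2 - r%:P).
  rewrite monicE lead_coefDl ?lead_coefXn // size_polyN size_polyC size_polyXn.
  by case: eqP.
by rewrite rmorphB /= map_polyXn map_polyC /root hornerD hornerN hornerXn hornerC z2 subrr.
Qed.

(** In lowest terms b1 / c1 of b / c, c1^2 divides f, which has no square
    factor. *)
Lemma square_dvd_separable (F : fieldType) (f b c : {poly F}) :
  coprimep f f^`() -> c != 0 -> c ^+ 2 %| b ^+ 2 * f -> c %| b.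
Proof.
move=> cop nz_c; have nz_d : gcdp b c != 0 by rewrite gcdp_eq0 (negPf nz_c) andbF.
have /dvdpP[b1 bE] := dvdp_gcdl b c; have /dvdpP[c1 cE] := dvdp_gcdr b c.
have cop1 : coprimep b1 c1.
  have -> : b1 = b %/ gcdp b c by rewrite {1}bE mulpK.
  have -> : c1 = c %/ gcdp b c by rewrite {1}cE mulpK.
  by rewrite coprimep_div_gcd // nz_c orbT.
move: (gcdp b c) nz_d bE cE => d nz_d bE cE.
rewrite {1}cE {1}bE !exprMn (mulrAC (b1 ^+ 2)) dvdp_mul2r ?expf_neq0 // => dvd.
have {}dvd : c1 ^+ 2 %| f.
  by rewrite -(@Gauss_dvdpr _ _ (b1 ^+ 2)) // coprimep_expl // coprimep_expr // coprimep_sym.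
have c1_1 : c1 %= 1.
  case/dvdpP: dvd => u fE; apply: (coprimepP _ _ cop).
    by rewrite fE exprS mulrCA dvdp_mulIl.
  rewrite fE expr2 !derivM dvdp_add ?dvdp_mull ?dvdp_mulIl //.
  by rewrite dvdp_add ?dvdp_mulIl ?dvdp_mulIr.
by rewrite cE (eqp_dvdl _ (eqp_mulr _ c1_1)) mul1r bE dvdp_mulIr.
Qed.

Section QuadraticCurve.
Variables (F L : fieldType) (iota : {rmorphism F -> L}) (x Y : L) (f : {poly F}).
Local Notation e := (evalp iota x).
Hypothesis transc : forall h : {poly F}, e h = 0 -> h = 0.
Hypothesis Y2 : Y ^+ 2 = e f.
Hypothesis Y_irr : forall h k : {poly F}, k != 0 -> Y * e k != e h.

Definition rational (z : L) := exists p q : {poly F}, q != 0 /\ z * e q = e p.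

Lemma rational_evalp p : rational (e p).
Proof. by exists p, 1; rewrite oner_neq0 rmorph1 mulr1. Qed.

Lemma rationalD z w : rational z -> rational w -> rational (z + w).
Proof.
move=> [p [q [nz_q zq]]] [p' [q' [nz_q' wq']]].
exists (p * q' + p' * q), (q * q'); split; first by rewrite mulf_neq0.
by rewrite rmorphD !rmorphM /= -zq -wq'; ring.
Qed.

Lemma rationalM z w : rational z -> rational w -> rational (z * w).
Proof.
move=> [p [q [nz_q zq]]] [p' [q' [nz_q' wq']]].
exists (p * p'), (q * q'); split; first by rewrite mulf_neq0.
by rewrite !rmorphM /= -zq -wq'; ring.
Qed.

(** This is the irreducibility of Y^2 - f over F(x). *)
Lemma rational_indep u v : rational u -> rational v -> u + v * Y = 0 -> u = 0 /\ v = 0.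
Proof.
move=> [p [q [nz_q uq]]] [p' [q' [nz_q' vq']]] uvY.
have nz : e q != 0 by rewrite evalp_eq0.
have nz' : e q' != 0 by rewrite evalp_eq0.
have v0 : v = 0.
  apply/eqP/negPn/negP => nz_v.
  have nz_p' : p' != 0.
    by rewrite -(evalp_eq0 transc) -vq' mulf_neq0.
  have := Y_irr (- (p * q')) (mulf_neq0 nz_p' nz_q); case/negP.
  rewrite rmorphN !rmorphM /= -uq -vq' (_ : u = - (v * Y)); last first.
    by apply/eqP; rewrite -addr_eq0 uvY.
  by apply/eqP; ring.
by move: uvY; rewrite v0 mul0r addr0.
Qed.

(** The conjugate u - v Y is a root of the same monic polynomial: the values of
    any polynomial over F(x) at u + v Y and u - v Y have the forms a + b Y and
    a - b Y, and the first one vanishes only if a = b = 0.  The ring R stands for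
    F[x] or F[1/x]. *)
Lemma integral_conj (R : comNzRingType) (rho : {rmorphism R -> L}) u v :
  (forall r, rational (rho r)) -> rational u -> rational v ->
  integralOver rho (u + v * Y) -> integralOver rho (u - v * Y).
Proof.
move=> rat_rho rat_u rat_v [M mon_M rootM]; exists M => //.
have [a [b [rat_a rat_b E1 E2]]] : exists a b, [/\ rational a, rational b,
    (map_poly rho M).[u + v * Y] = a + b * Y
  & (map_poly rho M).[u - v * Y] = a - b * Y].
  elim/poly_ind: M {mon_M rootM} => [|M c [a [b [rat_a rat_b E1 E2]]]].
    exists 0, 0; rewrite rmorph0 !horner0 mul0r subr0 addr0.
    by split=> //; rewrite -(rmorph0 e); apply: rational_evalp.
  exists (a * u + b * v * e f + rho c), (a * v + b * u).
  rewrite rmorphD rmorphM /= map_polyX map_polyC !hornerE E1 E2 -Y2.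
  split; [| |by ring|by ring].
    apply: rationalD => //; apply: rationalD; first exact: rationalM.
    by rewrite Y2; apply/rationalM/rational_evalp/rationalM.
  by apply: rationalD; apply: rationalM.
move/rootP: rootM; rewrite E1 => /(rational_indep rat_a rat_b)[a0 b0].
by apply/rootP; rewrite E2 a0 b0 mul0r subr0.
Qed.

Hypothesis nz2 : 2 != 0 :> F.
Let nz2L : 2 != 0 :> L.
Proof. by rewrite -(rmorph_nat iota) fmorph_eq0. Qed.

Lemma integral_trace_norm (R : comNzRingType) (rho : {rmorphism R -> L}) u v :
  (forall r, rational (rho r)) -> rational u -> rational v ->
  integralOver rho (u + v * Y) ->
  integralOver rho (2 * u) /\ integralOver rho (u ^+ 2 - v ^+ 2 * e f).
Proof.
move=> rat_rho rat_u rat_v int_z; have int_z' := integral_conj rat_rho rat_u rat_v int_z.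
split.
  have -> : 2 * u = (u + v * Y) + (u - v * Y) by ring.
  exact: integral_add.
have -> : u ^+ 2 - v ^+ 2 * e f = (u + v * Y) * (u - v * Y) by rewrite -Y2; ring.
exact: integral_mul.
Qed.

Hypothesis cop : coprimep f f^`().
Hypothesis gen : forall z : L, exists a b c : {poly F},
  c != 0 /\ z * e c = e a + e b * Y.

Lemma ring_U_Y a b : ring_U iota x (e a + e b * Y).
Proof.
apply: integral_add; first exact: integral_id.
by apply: integral_mul; [apply: integral_id | apply: integral_sqrt Y2].
Qed.

(** If z = (a + b Y) / c is integral, so is its trace 2 a / c, which is therefore
    a polynomial; then the norm shows that c^2 divides b^2 f, and c divides b
    because f is separable. *)
Lemma ring_UP z : ring_U iota x z -> exists a b, z = e a + e b * Y.
Proof.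
have [a [b [c [nz_c zc]]]] := gen z.
have nz_ec : e c != 0 by rewrite evalp_eq0.
have zE : z = e a / e c + e b / e c * Y.
  by apply: (mulIf nz_ec); rewrite zc; field.
have rat_q p : rational (e p / e c) by exists p, c; rewrite divfK.
rewrite zE => /integral_trace_norm[] //; first exact: rational_evalp.
move=> int_tr int_norm.
have [r ar] : exists r, e a / e c = e r.
  have [|r rE] := @evalp_integrally_closed _ _ _ _ transc _ (2 *: a) c int_tr nz_c.
    by rewrite scaler_nat rmorphMn /= mulrA divfK // mulr_natl.
  exists (2^-1 *: r); rewrite -mul_polyC rmorphM /= evalpC -rE fmorphV rmorph_nat.
  by rewrite mulKf.
have [m normE] : exists m, (e a / e c) ^+ 2 - (e b / e c) ^+ 2 * e f = e m.
  apply: (@evalp_integrally_closed _ _ _ _ transc _ (a ^+ 2 - b ^+ 2 * f) (c ^+ 2)) => //.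
    by rewrite expf_neq0.
  by rewrite rmorphB rmorphM !rmorphXn /=; field.
have /dvdpP[b' bE] : c %| b.
  apply: (square_dvd_separable cop nz_c).
  apply/dvdpP; exists (r ^+ 2 - m); apply: (evalp_inj transc).
  rewrite !rmorphM rmorphB !rmorphXn /= -normE -ar /=; field.
  exact: nz_ec.
exists r, b'; rewrite ar bE; congr (_ + _ * _).
by rewrite rmorphM /= mulfK.
Qed.
End QuadraticCurve.

(** * Behaviour at infinity *)

(** The reciprocal polynomial X^n p(1 / X), for p of degree at most n. *)
Definition revp (R : nzSemiRingType) n (p : {poly R}) : {poly R} :=
  \poly_(i < n.+1) p`_(n - i).

Lemma evalp_wide (F L : fieldType) (iota : {rmorphism F -> L}) (z : L) n (p : {poly F}) :
  (size p <= n)%N -> evalp iota z p = \sum_(i < n) iota p`_i * z ^+ i.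
Proof.
move=> sp; rewrite /evalp (@horner_coef_wide _ n); last first.
  by rewrite (leq_trans (size_poly _ _)).
by apply: eq_bigr => i _; rewrite coef_map.
Qed.

Section Infinity.
Variables (F L : fieldType) (iota : {rmorphism F -> L}) (x : L).
Local Notation e := (evalp iota x).
Local Notation e' := (evalp iota x^-1).
Hypothesis transc : forall h : {poly F}, e h = 0 -> h = 0.
Let nz_x := x_neq0 transc.

Lemma evalp_revp n (p : {poly F}) : (size p <= n.+1)%N -> e p = x ^+ n * e' (revp n p).
Proof.
move=> sp; rewrite (evalp_wide iota x sp) (evalp_wide iota _ (size_poly _ _)) big_distrr /=.
rewrite (reindex_inj rev_ord_inj) /=; apply: eq_bigr => i _.
rewrite coef_poly ltn_ord subSS mulrCA; congr (_ * _).
have le_in : (i <= n)%N by rewrite -ltnS.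
by rewrite exprVn; apply: (canRL (mulfK _)); rewrite ?expf_neq0 // -exprD subnK.
Qed.

Lemma evalp_inv_revp n (p : {poly F}) : (size p <= n.+1)%N -> e' p = e (revp n p) / x ^+ n.
Proof.
move=> sp; rewrite (@evalp_revp n) ?size_poly // mulrAC mulfV ?mul1r ?expf_neq0 //.
congr e'; apply/polyP => i; rewrite !coef_poly ltnS.
have [le_in|lt_ni] := leqP i n; last by rewrite nth_default // (leq_trans sp).
by rewrite ltnS leq_subr subKn.
Qed.

Lemma transc_inv h : e' h = 0 -> h = 0.
Proof.
move=> h0; have sh : (size h <= (size h).+1)%N by [].
have := evalp_inv_revp sh; rewrite h0 => /esym/eqP.
rewrite mulf_eq0 invr_eq0 expf_eq0 (negPf nz_x) andbF orbF evalp_eq0 // => /eqP rev0.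
apply/polyP => i; rewrite coef0; have [lt_i|/leq_sizeP->//] := ltnP i (size h).
have := congr1 (fun p : {poly F} => p`_(size h - i)) rev0.
by rewrite coef0 coef_poly ltnS leq_subr subKn // ltnW.
Qed.

Lemma rational_evalp_inv p : rational iota x (e' p).
Proof.
exists (revp (size p) p), ('X^(size p)); rewrite expf_neq0 ?polyX_eq0 //; split=> //.
by rewrite (@evalp_inv_revp (size p)) // rmorphXn /= evalpX divfK // expf_neq0.
Qed.

(** Integrality over F[1/x] forbids poles at infinity.  Otherwise, with m the
    degree of g, g / x^k is the fraction rev(g) / T^(m - k) in T = 1 / x; it
    would be a polynomial in T although rev(g) does not vanish at T = 0. *)
Lemma pole_order_integral g k : ring_V iota x (e g / x ^+ k) -> (size g <= k.+1)%N.
Proof.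
move=> int_g; rewrite leqNgt; apply/negP => lt_k.
pose m := (size g).-1; have nz_g : g != 0 by rewrite -size_poly_gt0 (leq_trans _ lt_k).
have sg : size g = m.+1 by rewrite polySpred.
have lt_km : (k < m)%N by rewrite -ltnS -sg.
have gE : e g / x ^+ k * e' 'X^(m - k) = e' (revp m g).
  rewrite rmorphXn /= evalpX (@evalp_revp m) ?sg // exprVn.
  rewrite -[X in x ^+ X * _](subnK (ltnW lt_km)) exprD.
  by field; rewrite !expf_neq0.
have nz_X : 'X^(m - k) != 0 :> {poly F} by rewrite expf_neq0 ?polyX_eq0.
have [r rE] := evalp_integrally_closed transc_inv int_g nz_X gE.
have revE : revp m g = r * 'X^(m - k).
  by apply: (evalp_inj transc_inv); rewrite rmorphM /= -rE gE.
have := congr1 (fun p : {poly F} => p`_0) revE.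
rewrite coefMXn subn_gt0 lt_km coef_poly /= subn0 => /eqP.
by rewrite -[m]/((size g).-1) -lead_coefE lead_coef_eq0 (negPf nz_g).
Qed.
End Infinity.

(** * The genus *)

Section GenusTwo.
Variables (F L : fieldType) (iota : {rmorphism F -> L}) (x Y : L) (f : {poly F}).
Local Notation e := (evalp iota x).
Local Notation e' := (evalp iota x^-1).
Hypothesis transc : forall h : {poly F}, e h = 0 -> h = 0.
Hypothesis Y2 : Y ^+ 2 = e f.
Hypothesis Y_irr : forall h k : {poly F}, k != 0 -> Y * e k != e h.
Hypothesis nz2 : 2 != 0 :> F.
Hypothesis cop : coprimep f f^`().
Hypothesis gen : forall z : L, exists a b c : {poly F},
  c != 0 /\ z * e c = e a + e b * Y.
Hypothesis size_f : size f = 7.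
Let nz_x := x_neq0 transc.

(** The trace bounds the degree of a by 0, and then the norm bounds that of
    g^2 f / x^4, which is at least 2 unless g = 0 because f has degree 6.
    Both the triviality of H^0 and the independence of Y / x and Y / x^2 in H^1
    are instances. *)
Lemma ring_V_regular a g : ring_V iota x (e a + e g / x ^+ 2 * Y) ->
  (size a <= 1)%N /\ g = 0.
Proof.
have rat_g : rational iota x (e g / x ^+ 2).
  exists g, 'X^2; rewrite expf_neq0 ?polyX_eq0 //; split=> //.
  by rewrite rmorphXn /= evalpX divfK // expf_neq0.
move=> int_z.
have [int_tr int_norm] := integral_trace_norm transc Y2 Y_irr
  (rational_evalp_inv transc) (rational_evalp _ _ a) rat_g int_z.
have sa : (size a <= 1)%N.
  rewrite -(size_scale a nz2); apply: (pole_order_integral transc (k := 0)).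
  by rewrite expr0 divr1 scaler_nat rmorphMn /= -mulr_natl.
split=> //; apply/eqP/negPn/negP => nz_g.
have int_a : ring_V iota x (e a).
  by rewrite (size1_polyC sa) evalpC -(evalpC _ x^-1); apply: integral_id.
have : ring_V iota x (e (g ^+ 2 * f) / x ^+ 4).
  have -> : e (g ^+ 2 * f) / x ^+ 4 =
      e a * e a - (e a ^+ 2 - (e g / x ^+ 2) ^+ 2 * e f).
    by rewrite rmorphM rmorphXn /=; field.
  by apply: integral_sub => //; apply: integral_mul.
move/(pole_order_integral transc); rewrite leqNgt => /negP; apply.
rewrite size_mul ?expf_neq0 // -?size_poly_eq0 ?size_f //.
have : (0 < size (g ^+ 2))%N by rewrite size_poly_gt0 expf_neq0.
by case: (size _) => // n _; rewrite addnC.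
Qed.

Lemma H0_trivial_curve : H0_trivial iota x.
Proof.
move=> z /(ring_UP transc Y2 Y_irr nz2 cop gen)[a [b ->]].
have -> : e b = e (b * 'X^2) / x ^+ 2.
  by rewrite rmorphM rmorphXn /= evalpX mulfK // expf_neq0.
case/ring_V_regular => sa /eqP; rewrite mulf_eq0 expf_eq0 polyX_eq0 orbF => /eqP ->.
exists a`_0; rewrite mul0r rmorph0 mul0r mul0r addr0.
by rewrite {1}(size1_polyC sa) evalpC.
Qed.

(** The ring of functions on U `&` V is presented by F[x][T], T |-> 1 / x. *)
Definition eval_UV : {poly {poly F}} -> L := horner_eval x^-1 \o map_poly e.
HB.instance Definition _ := GRing.RMorphism.on eval_UV.

Lemma eval_UVC p : eval_UV p%:P = e p.
Proof. by rewrite /eval_UV /= /horner_eval map_polyC hornerC. Qed.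

Lemma eval_UVX : eval_UV 'X = x^-1.
Proof. by rewrite /eval_UV /= /horner_eval map_polyX hornerX. Qed.

Lemma eval_UV_mul_pow (p : {poly {poly F}}) k :
  (size p <= k)%N -> ring_U iota x (eval_UV p * x ^+ k).
Proof.
move=> sp; rewrite /eval_UV /= /horner_eval (@horner_coef_wide _ k); last first.
  by rewrite (leq_trans (size_poly _ _)).
rewrite big_distrl /=; apply: (big_ind (fun u => ring_U iota x u)).
- exact: integral0.
- by move=> u v; apply: integral_add.
move=> i _; rewrite coef_map /= -mulrA exprVn.
have -> : x ^- i * x ^+ k = e 'X^(k - i).
  rewrite rmorphXn /= evalpX mulrC; apply: (canLR (mulfK _)); first exact: expf_neq0.
  by rewrite -exprD subnK // ltnW.
by rewrite -rmorphM; apply: integral_id.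
Qed.

(** Multiplying z by x^N multiplies the coefficient of degree i of its monic
    equation, of degree d, by x^(N (d - i)), which clears the powers of 1 / x as
    soon as N is at least their exponents in all the coefficients. *)
Lemma ring_UV_mul_pow z : ring_UV iota x z -> exists n, ring_U iota x (z * x ^+ n).
Proof.
case=> M mon_M rootM; pose d := (size M).-1.
pose N := (\max_(i < d) size (M`_i)%R)%N; exists N.
have sM : (size M <= d.+1)%N by rewrite /d leqSpred.
have Md : M`_d = 1 by have := monicP mon_M; rewrite lead_coefE.
pose p : {poly L} := \poly_(i < d.+1) (eval_UV M`_i * x ^+ (N * (d - i))).
have pd : p`_d = 1 by rewrite coef_poly ltnSn Md subnn muln0 rmorph1 mulr1.
have sp : size p = d.+1.
  apply/eqP; rewrite eqn_leq size_poly ltnNge; apply/negP => /leq_sizeP/(_ d (leqnn d)).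
  by rewrite pd => /eqP; rewrite oner_eq0.
apply: (@integral_root_monic _ _ _ _ p).
- by rewrite monicE lead_coefE sp pd.
- apply/rootP; rewrite (@horner_coef_wide _ d.+1) ?sp //.
  transitivity ((map_poly eval_UV M).[z] * x ^+ (N * d)); last by rewrite (rootP rootM) mul0r.
  rewrite (@horner_coef_wide _ d.+1); last by rewrite (leq_trans (size_poly _ _)).
  rewrite big_distrl /=; apply: eq_bigr => i _.
  rewrite coef_poly ltn_ord coef_map /= exprMn -exprM -!mulrA; congr (_ * _).
  rewrite mulrCA; congr (_ * _); rewrite -exprD; congr (_ ^+ _).
  by rewrite -mulnDr subnK // -ltnS.
apply/integral_poly => i; rewrite coef_poly; case: ltnP => [le_id|_]; last exact: integral0.
move: le_id; rewrite ltnS leq_eqVlt => /predU1P[->|lt_id].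
  by rewrite Md subnn muln0 rmorph1 mulr1; apply: integral1.
apply: eval_UV_mul_pow; rewrite -(subnSK lt_id) mulnS.
apply: leq_trans (leq_addr _ _).
exact: (leq_bigmax (Ordinal lt_id)).
Qed.

Definition H1_basis (i : 'I_2) : L := Y / x ^+ i.+1.

Lemma H1_basis_UV i : ring_UV iota x (H1_basis i).
Proof.
apply: (@integral_sqrt _ _ eval_UV _ (f%:P * 'X^(i.+1.*2))).
rewrite rmorphM rmorphXn /= eval_UVC eval_UVX -Y2 /H1_basis exprMn exprVn -!exprM muln2.
by rewrite exprVn.
Qed.

(** Y / x^3 is integral over F[1/x] because its square is x^-6 f(x). *)
Lemma ring_V_Y a c : ring_V iota x (e' a + e' c * (Y / x ^+ 3)).
Proof.
apply: integral_add; first exact: integral_id.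
apply: integral_mul; first exact: integral_id.
apply: (@integral_sqrt _ _ _ _ (revp 6 f)).
have sf : (size f <= 7)%N by rewrite size_f.
rewrite exprMn Y2 (evalp_revp transc sf) exprVn -exprM mulrC mulKf //.
by rewrite expf_neq0.
Qed.

(** An element of O(U `&` V) is (a + b Y) / x^n.  The part of a / x^n + (b / x^n) Y
    with nonnegative powers of x is in O(U); the powers x^-k are in O(V), and
    so are the products x^-k Y with k at least 3.  There remain Y / x and
    Y / x^2, whose independence comes from [ring_V_regular]. *)
Lemma H1_dim_curve : H1_dim iota x 2.
Proof.
exists H1_basis; split=> [i|z int_z]; first exact: H1_basis_UV.
have [n] := ring_UV_mul_pow int_z.
case/(ring_UP transc Y2 Y_irr nz2 cop gen) => a [b zE].
have nz_xn k : x ^+ k != 0 by rewrite expf_neq0.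
(* The constant term goes with the polynomial part, hence p2`_0 = 0. *)
have split_pole p : exists p1 p2, e p / x ^+ n = e p1 + e' p2 /\ p2`_0 = 0.
  have st : (size (take_poly n p) <= n.+1)%N by rewrite (leq_trans (size_take_poly _ _)).
  exists (drop_poly n p), (revp n (take_poly n p)); split; last first.
    by rewrite coef_poly /= subn0 coef_take_poly ltnn.
  rewrite -{1}(poly_take_drop n p) rmorphD rmorphM rmorphXn /= evalpX.
  by rewrite (evalp_revp transc st); field.
have [a1 [a2 [aE _]]] := split_pole a.
have [b1 [b2 [bE b20]]] := split_pole b.
have {zE}zE : z = (e a1 + e b1 * Y) + (e' a2 + e' b2 * Y).
  transitivity ((e a + e b * Y) / x ^+ n); first by rewrite -zE mulfK.
  rewrite mulrDl aE -mulrA [Y / _]mulrC mulrA bE; ring.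
pose b3 := drop_poly 3 b2.
have b2E : e' b2 = iota b2`_1 / x + iota b2`_2 / x ^+ 2 + e' b3 / x ^+ 3.
  rewrite -{1}(poly_take_drop 3 b2) rmorphD rmorphM rmorphXn /= evalpX exprVn.
  rewrite (@evalp_wide _ _ _ _ 3) ?size_take_poly // !big_ord_recl big_ord0 /=.
  rewrite !coef_take_poly /= b20 rmorph0 mul0r add0r addr0 /bump /= !add1n expr1.
  by rewrite exprVn.
have sumE (c : 'rV[F]_2) : \sum_(i < 2) iota (c 0 i) * H1_basis i =
    iota (c 0 0) * (Y / x) + iota (c 0 1) * (Y / x ^+ 2).
  rewrite !big_ord_recl big_ord0 addr0 /H1_basis expr1.
  by congr (_ + iota (c 0 _) * _); apply: val_inj.
pose c : 'rV[F]_2 := \row_i b2`_i.+1.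
exists c; split.
  exists (e a1 + e b1 * Y), (e' a2 + e' b3 * (Y / x ^+ 3)).
  split; first exact: ring_U_Y Y2 a1 b1.
  split; first exact: ring_V_Y.
  rewrite zE sumE !mxE /= b2E; field.
  by rewrite nz_x.
move=> c' [u [v [int_u [int_v zE']]]].
case/(ring_UP transc Y2 Y_irr nz2 cop gen): int_u => a' [b' uE].
have int_V0 := ring_V_Y a2 b3.
pose d i := c 0 i - c' 0 i.
(* g / x^2 is the coefficient of Y in the difference of two decompositions. *)
pose g := (b1 - b') * 'X^2 + (d 0)%:P * 'X + (d 1)%:P.
have : ring_V iota x (e (a1 - a') + e g / x ^+ 2 * Y).
  have -> : e (a1 - a') + e g / x ^+ 2 * Y = v - (e' a2 + e' b3 * (Y / x ^+ 3)).
    have -> : v = z - u - \sum_(i < 2) iota (c' 0 i) * H1_basis i by rewrite zE'; ring.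
    rewrite sumE uE zE b2E /g /d !mxE /= !(rmorphB, rmorphD, rmorphM, rmorphXn) /=.
    rewrite !evalpC evalpX ?rmorphB /=; field.
    by rewrite nz_x.
  exact: integral_sub.
case/ring_V_regular => _ g0; apply/rowP => i; apply/eqP; rewrite -subr_eq0; apply/eqP.
have gE k : g`_k = 0 by rewrite g0 coef0.
have d1 : d 1 = 0 by have := gE 0%N; rewrite !(coefD, coefMXn, coefMX, coefC) !add0r.
have d0 : d 0 = 0.
  by have := gE 1%N; rewrite !(coefD, coefMXn, coefMX, coefC) /= add0r addr0.
case: i => [[|[|//]] lt_i]; first by rewrite -[RHS]d0; congr (c 0 _ - c' 0 _); apply: val_inj.
by rewrite -[RHS]d1; congr (c 0 _ - c' 0 _); apply: val_inj.
Qed.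
End GenusTwo.

Section DescribesGenusTwo.
Variables (F : fieldType) (W : weierstrass F).
Local Notation f := (4 *: wP W + wQ W ^+ 2).

Lemma describes_genus_two :
  2 != 0 :> F -> (size (wQ W) <= 4)%N -> (size (wP W) <= 7)%N ->
  coprimep f f^`() -> size f = 7 -> describes_genus 2 W.
Proof.
move=> nz2 sQ sP cop sf.
have [|L [iota [x [y ff]]]] := function_field_exists nz2 sQ sP cop; first by rewrite sf.
have [_ _ eq_xy transc irr gen] := ff.
have nz2L : 2 != 0 :> L by rewrite -(rmorph_nat iota) fmorph_eq0.
pose Y := 2 * y + evalp iota x (wQ W).
have Y2 : Y ^+ 2 = evalp iota x f.
  rewrite scaler_nat rmorphD rmorphXn rmorphMn /= -eq_xy /Y; ring.
have Y_irr (h k : {poly F}) : k != 0 -> Y * evalp iota x k != evalp iota x h.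
  move=> nz_k; apply/eqP => YE.
  apply: (irr (2^-1 *: (h - wQ W * k)) k); first exact/eqP.
  rewrite -mul_polyC !(rmorphM, rmorphB) /= evalpC -YE fmorphV rmorph_nat /Y.
  by field.
have Y_gen (z : L) : exists a b c : {poly F},
    c != 0 /\ z * evalp iota x c = evalp iota x a + evalp iota x b * Y.
  have [a [b [c [/eqP nz_c zE]]]] := gen z.
  exists (a *+ 2 - b * wQ W), b, (c *+ 2); split.
    by rewrite -scaler_nat scaler_eq0 (negPf nz2).
  rewrite !(rmorphB, rmorphMn, rmorphM) /= mulrnAr zE /Y; ring.
exists L, iota, x, y; split=> //.
  exact: (@H0_trivial_curve _ _ _ _ Y f).
exact: (@H1_dim_curve _ _ _ _ Y f).
Qed.
End DescribesGenusTwo.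

(** * Changing the equation and the base field *)

Lemma evalp_comp (F L : fieldType) (iota : {rmorphism F -> L}) (x : L) (h m : {poly F}) :
  evalp iota x (h \Po m) = evalp iota (evalp iota x m) h.
Proof. by rewrite /evalp map_comp_poly horner_comp. Qed.

(** The substitution x = r + s x', 2 y + Q = s^3 y' turns Y^2 = f(x) into
    y'^2 = s^-6 f(r + s x'), and it is invertible, so that x', y' generate the
    same field. *)
Lemma change_coordinates (F L : fieldType) (W : weierstrass F)
    (iota : {rmorphism F -> L}) (x y : L) (s r : F)
    (f := 4 *: wP W + wQ W ^+ 2) (m := s *: 'X + r%:P) :
  2 != 0 :> F -> s != 0 -> (size f <= 7)%N ->
  function_field_of W iota x y ->
  function_field_of (Weierstrass 0 (s ^- 6 *: (f \Po m))) iota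
    ((x - iota r) / iota s) ((2 * y + evalp iota x (wQ W)) / iota s ^+ 3).
Proof.
move=> nz2 nz_s sf [sQ sP eq_xy transc irr gen].
have nz2L : 2 != 0 :> L by rewrite -(rmorph_nat iota) fmorph_eq0.
have nz_is : iota s != 0 by rewrite fmorph_eq0.
set x' := _ / iota s; set y' := _ / iota s ^+ 3.
have xE : x = evalp iota x' m.
  by rewrite /m -mul_polyC rmorphD rmorphM /= !evalpC evalpX /x' mulrC divfK // subrK.
have evalpE h : evalp iota x h = evalp iota x' (h \Po m) by rewrite evalp_comp -xE.
pose m' := s^-1 *: 'X + (- (r / s))%:P.
have x'E : x' = evalp iota x m'.
  rewrite /m' -mul_polyC rmorphD rmorphM /= !evalpC evalpX rmorphN fmorphV fmorph_div /x'.
  by field.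
have evalpE' h : evalp iota x' h = evalp iota x (h \Po m') by rewrite evalp_comp -x'E.
have sm' : size m' = 2 by apply: size_affine; rewrite invr_eq0.
have Y2 : (2 * y + evalp iota x (wQ W)) ^+ 2 = evalp iota x f.
  rewrite /f scaler_nat rmorphD rmorphXn rmorphMn /= -eq_xy; ring.
split=> /=.
- by rewrite size_poly0.
- by rewrite (leq_trans (size_scale_leq _ _)) // size_comp_affine.
- rewrite rmorph0 mul0r addr0 -mul_polyC rmorphM /= evalpC fmorphV rmorphXn -evalpE -Y2 /y'.
  by field.
- move=> h; rewrite evalpE' => /transc/eqP; rewrite comp_poly2_eq0 //.
  by move/eqP.
- move=> h k nz_k; rewrite !evalpE' => yk.
  apply: (irr ((2^-1)%:P * ((s ^+ 3)%:P * (h \Po m') - wQ W * (k \Po m'))) (k \Po m')).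
    by apply/eqP; rewrite comp_poly2_eq0 //; apply/eqP.
  rewrite rmorphM rmorphB !rmorphM /= !evalpC -yk fmorphV rmorph_nat /y'.
  by field; rewrite nz2L nz_is.
move=> z; have [a [b [c [nz_c zE]]]] := gen z.
exists ((a *+ 2 - b * wQ W) \Po m), ((s ^+ 3 *: b) \Po m), ((c *+ 2) \Po m); split.
  apply/eqP; rewrite comp_poly2_eq0; last exact: size_affine.
  by rewrite -scaler_nat scaler_eq0 (negPf nz2); apply/eqP.
rewrite -!evalpE -mul_polyC !(rmorphM, rmorphB, rmorphMn) /= evalpC ?rmorphXn mulrnAr zE /y'.
by field.
Qed.

Lemma discr_map (F F' : fieldType) (phi : {rmorphism F -> F'}) n (p : {poly F}) :
  n.+1%:R != 0 :> F -> size p = n.+2 -> discr (map_poly phi p) = phi (discr p).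
Proof.
move=> nz_n sp; have sd := size_deriv_char nz_n sp.
rewrite /discr deriv_map (@resultant_sylv _ n.+1 n) ?size_map_poly //.
rewrite (@resultant_sylv _ n.+1 n p) // lead_coef_map fmorph_div rmorphM rmorph_sign.
congr (_ * _ / _); rewrite -det_map_mx; congr (\det _).
by apply/matrixP => i j; rewrite [RHS]mxE !sylvE !coef_map; case: ifP => _; rewrite rmorphMn.
Qed.

Lemma coef6_neq0 (R : nzRingType) (f : {poly R}) : size f = 7 -> f`_6 != 0.
Proof.
by move=> sf; have := lead_coefE f; rewrite sf => <-; rewrite lead_coef_eq0 -size_poly_gt0 sf.
Qed.

Lemma base_change_sextic (F F' : fieldType) (phi : {rmorphism F -> F'}) (W : weierstrass F) :
  4 *: wP (base_change phi W) + wQ (base_change phi W) ^+ 2 =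
  map_poly phi (4 *: wP W + wQ W ^+ 2).
Proof. by rewrite /= !scaler_nat rmorphD rmorphXn rmorphMn. Qed.

Lemma wdisc_map (F F' : fieldType) (phi : {rmorphism F -> F'}) (W : weierstrass F) :
  6 != 0 :> F -> size (4 *: wP W + wQ W ^+ 2) = 7 ->
  wdisc (base_change phi W) = phi (wdisc W).
Proof.
move=> nz6 sf; rewrite /wdisc base_change_sextic.
set f := 4 *: _ + _ in sf *.
have nz6f := coef6_neq0 sf.
rewrite /disc6 coef_map fmorph_eq0 nz6f (discr_map _ nz6) //.
by move: (discr f) => d; rewrite rmorphM fmorphV rmorphXn rmorph_nat.
Qed.

Lemma coprime_of_wdisc (F : fieldType) (W : weierstrass F) (f := 4 *: wP W + wQ W ^+ 2) :
  size f = 7 -> wdisc W != 0 -> coprimep f f^`().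
Proof.
move=> sf; rewrite /wdisc /disc6 -/f mulf_eq0 negb_or => /andP[_].
rewrite coef6_neq0 //.
rewrite /discr !mulf_eq0 !negb_or -andbA => /and3P[_ res _].
rewrite coprimep_def eqn_leq; move: res; rewrite resultant_eq0 -leqNgt => -> /=.
by rewrite size_poly_gt0 gcdp_eq0 negb_and -size_poly_gt0 sf.
Qed.

(** * Discrete valuations *)

Section Valuation.
Variables (L : fieldType) (v : L -> int).
Hypothesis dv : discrete_valuation v.

Lemma val_one : v 1 = 0.
Proof.
have nz1 : 1 <> 0 :> L by apply/eqP/oner_neq0.
by have := dv_mul dv nz1 nz1; rewrite mulr1; lia.
Qed.

Lemma val_opp_one : v (-1) = 0.
Proof.
have nz1 : -1 <> 0 :> L by apply/eqP; rewrite oppr_eq0 oner_neq0.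
have := dv_mul dv nz1 nz1; rewrite mulrNN mulr1 val_one -mulr2n => /esym/eqP.
by rewrite mulrn_eq0 /= => /eqP.
Qed.

Lemma vgeM m n x y : vge v m x -> vge v n y -> vge v (m + n) (x * y).
Proof.
case=> [->|vx]; first by rewrite mul0r; left.
case=> [->|vy]; first by rewrite mulr0; left.
have [->|/eqP nz_x] := eqVneq x 0; first by rewrite mul0r; left.
have [->|/eqP nz_y] := eqVneq y 0; first by rewrite mulr0; left.
by right; rewrite dv_mul // lerD.
Qed.

Lemma vgeN n x : vge v n x -> vge v n (- x).
Proof.
rewrite -mulN1r -[n in vge v n (_ * _)]add0r; apply: vgeM.
by right; rewrite val_opp_one.
Qed.

Lemma vge_integral_mul n x y : vge v 0 x -> vge v n y -> vge v n (x * y).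
Proof. by move=> vx vy; rewrite -[n]add0r; apply: vgeM. Qed.

Lemma vge_weaken m n x : m <= n -> vge v n x -> vge v m x.
Proof. by move=> le_mn [->|le_n]; [left | right; apply: le_trans le_n]. Qed.

Lemma vge0_1 : vge v 0 1. Proof. by right; rewrite val_one. Qed.

Lemma vgeX n x : vge v 0 x -> vge v 0 (x ^+ n).
Proof.
by move=> vx; elim: n => [|n IH]; [exact: vge0_1 | rewrite exprS; apply: vge_integral_mul].
Qed.

Lemma vge0_nat n : vge v 0 n%:R.
Proof.
elim: n => [|n IH]; first by left.
by rewrite mulrS; apply: dv_add => //; apply: vge0_1.
Qed.

Lemma vge0_int m : vge v 0 m%:~R.
Proof. by case: m => n; [|rewrite NegzE mulrNz; apply: vgeN]; apply: vge0_nat. Qed.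

Lemma not_vge1_1 : ~ vge v 1 1.
Proof. by case=> [/eqP|]; [rewrite oner_eq0 | rewrite val_one]. Qed.

Lemma vunit_vge0 x : vunit v x -> vge v 0 x.
Proof. by case=> _ vx; right; rewrite vx. Qed.

Lemma not_vge1_vunit x : vge v 0 x -> ~ vge v 1 x -> vunit v x.
Proof.
move=> [->|vx] n1; first by case: n1; left.
have nz : x <> 0 by move=> x0; apply: n1; left.
split=> //; apply/eqP; rewrite eq_le vx andbT leNgt; apply/negP => lt0.
by apply: n1; right; lia.
Qed.

Lemma vunit_not_vge1 x : vunit v x -> ~ vge v 1 x.
Proof. by move=> [nz vx] [//|]; rewrite vx. Qed.

Lemma vunitM x y : vunit v x -> vunit v y -> vunit v (x * y).
Proof.
move=> [/eqP nx vx] [/eqP ny vy]; split; first by apply/eqP; rewrite mulf_neq0.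
by rewrite dv_mul ?vx ?vy //; apply/eqP.
Qed.

Lemma vunitN x : vunit v x -> vunit v (- x).
Proof.
rewrite -mulN1r; apply: vunitM; split; last exact: val_opp_one.
by apply/eqP; rewrite oppr_eq0 oner_neq0.
Qed.

Lemma vunit1 : vunit v 1.
Proof. by split; [apply/eqP/oner_neq0 | exact: val_one]. Qed.

Lemma vunitX n x : vunit v x -> vunit v (x ^+ n).
Proof.
move=> ux; elim: n => [|n IH]; last by rewrite exprS; apply: vunitM.
exact: vunit1.
Qed.

Lemma vunitV x : vunit v x -> vunit v x^-1.
Proof.
move=> [/eqP nx vx]; have nV : x^-1 != 0 by rewrite invr_eq0.
split; first exact/eqP.
have /eqP nx' := nx; have /eqP nV' := nV.
by have := dv_mul dv nx' nV'; rewrite mulfV // val_one vx add0r.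
Qed.

Lemma vunit_factor x y : vge v 0 x -> vge v 0 y -> vunit v (x * y) -> vunit v x.
Proof.
move=> vx vy uxy; apply: not_vge1_vunit => // x1.
by apply: (vunit_not_vge1 uxy); rewrite mulrC; apply: vge_integral_mul.
Qed.

Lemma sqrt_vge0 x : vge v 0 (x ^+ 2) -> vge v 0 x.
Proof.
have [->|/eqP nz] := eqVneq x 0; first by left.
case=> [/eqP|]; first by rewrite expf_eq0 /= => /eqP.
by rewrite expr2 dv_mul // => h; right; lia.
Qed.
End Valuation.

Lemma vge_decidable (L : fieldType) (v : L -> int) n x : vge v n x \/ ~ vge v n x.
Proof.
have [->|/eqP nz_x] := eqVneq x 0; first by left; left.
by have [le_n|lt_n] := boolP (n <= v x); [left; right | right=> -[//|]; apply/negP].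
Qed.

(** * A model with good reduction at the primes dividing A *)

Lemma map_radic (F F' : fieldType) (phi : {rmorphism F -> F'}) j :
  phi (radic j) = radic (phi j).
Proof. by rewrite /radic !(rmorphXn, rmorph_nat, rmorphN, rmorphM, rmorphD). Qed.

Lemma map_sextic (F F' : fieldType) (phi : {rmorphism F -> F'}) w :
  map_poly phi (sextic w) = sextic (phi w).
Proof.
apply/polyP => i; rewrite coef_map !coef_Poly.
do 7![case: i => [|i]; first by
  rewrite /= !(rmorphXn, rmorph_nat, rmorphN, rmorphM, rmorphD)].
by rewrite /= !nth_default ?rmorph0.
Qed.

Lemma map_scaled_sextic (F F' : fieldType) (phi : {rmorphism F -> F'}) j :
  map_poly phi (scaled_sextic j) = scaled_sextic (phi j).
Proof.
rewrite /scaled_sextic map_polyZ map_comp_poly map_sextic rmorphD /= map_polyZ.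
rewrite map_polyX map_polyC /= rmorph0 /param_w /param_r.
by rewrite !(fmorphV, rmorphXn, rmorph_nat, rmorphM).
Qed.

Section BadPrime.
Variables (L : fieldType) (v : L -> int) (j s eps m : L).
Hypothesis dv : discrete_valuation v.
Hypothesis int_j : vge v 0 j.
Hypothesis int_m : vge v 0 m.
Hypothesis A_mod20 : radic j = 20 * m + 13.
Hypothesis A_square : radic j = eps * s ^+ 2.
Hypothesis unit_eps : vunit v eps.
Hypothesis A_bad : vge v 1 (radic j).
Hypothesis nz_s : s != 0.

(** A = 20 m + 13 and 2 would both be in the maximal ideal, which would contain 1. *)
Lemma vunit2 : vunit v 2.
Proof.
apply: not_vge1_vunit => [|v2]; first exact: vge0_nat.
apply: (not_vge1_1 dv).
have -> : 1 = radic j + 2 * - (10 * m + 6) :> L by rewrite A_mod20; ring.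
apply: dv_add => //; rewrite mulrC; apply: vge_integral_mul => //.
apply: vgeN => //; apply: dv_add => //; last exact: vge0_nat.
by apply: vge_integral_mul => //; apply: vge0_nat.
Qed.

(** Likewise, from 2 A - 5 (8 m + 5) = 1. *)
Lemma vunit5 : vunit v 5.
Proof.
apply: not_vge1_vunit => [|v5]; first exact: vge0_nat.
apply: (not_vge1_1 dv).
have -> : 1 = 2 * radic j + (- (8 * m + 5)) * 5 :> L by rewrite A_mod20; ring.
apply: dv_add => //; apply: vge_integral_mul => //; first exact: vge0_nat.
apply: vgeN => //; apply: dv_add => //; last exact: vge0_nat.
by apply: vge_integral_mul => //; apply: vge0_nat.
Qed.

Lemma vunit10 : vunit v 10.
Proof. by rewrite (natrM _ 2 5); apply: vunitM; [|exact: vunit2|exact: vunit5]. Qed.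

Lemma vunit8 : vunit v 8.
Proof. by rewrite (natrX _ 2 3); apply: vunitX => //; exact: vunit2. Qed.

Lemma vunit32 : vunit v 32.
Proof. by rewrite (natrX _ 2 5); apply: vunitX => //; exact: vunit2. Qed.

(** 729 j^5 is A plus a unit.  It follows that its factors 3 and j are units. *)
Lemma vunit_729j5 : vunit v (729 * j ^+ 5).
Proof.
have unit_c : vunit v (32 * 10 ^+ 5).
  by apply: vunitM; [|exact: vunit32|apply: vunitX => //; exact: vunit10].
apply: not_vge1_vunit.
  by apply: vge_integral_mul => //; [exact: vge0_nat | exact: vgeX].
move=> bad; apply: (vunit_not_vge1 unit_c).
have -> : 32 * 10 ^+ 5 = 729 * j ^+ 5 - radic j :> L by rewrite /radic; ring.
by apply: dv_add => //; apply: vgeN.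
Qed.

Lemma vunit_j : vunit v j.
Proof.
have h : vunit v (j * (729 * j ^+ 4)).
  by rewrite (_ : _ * _ = 729 * j ^+ 5); [exact: vunit_729j5 | ring].
apply: vunit_factor h => //.
by apply: vge_integral_mul => //; [exact: vge0_nat | exact: vgeX].
Qed.

Lemma vunit9 : vunit v 9.
Proof.
have h : vunit v (9 * (81 * j ^+ 5)).
  by rewrite (_ : _ * _ = 729 * j ^+ 5); [exact: vunit_729j5 | ring].
apply: vunit_factor h => //; first exact: vge0_nat.
by apply: vge_integral_mul => //; [exact: vge0_nat | exact: vgeX].
Qed.

Local Notation w := (param_w j).
Local Notation r := (param_r j).

Lemma vunit_r : vunit v r.
Proof.
rewrite /param_r; apply: vunitM => //.
  by apply: vunitM => //; [exact: vunit9 | apply: vunitX => //; exact: vunit_j].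
apply: vunitV => //; apply: vunitM => //; first exact: vunit8.
by apply: vunitX => //; exact: vunit10.
Qed.

Let D : L := 32 * 10 ^+ 5.
Lemma vunit_D : vunit v D.
Proof. by apply: vunitM; [|exact: vunit32|apply: vunitX => //; exact: vunit10]. Qed.

Lemma w_sub1 : w - 1 = eps / D * s ^+ 2.
Proof.
have /eqP nz := vunit_D.1.
rewrite mulrAC -A_square /param_w /radic -/D.
by field.
Qed.

Lemma int_s : vge v 0 s.
Proof.
apply: sqrt_vge0 => //; have -> : s ^+ 2 = eps^-1 * radic j.
  by rewrite A_square mulKf //; apply/eqP/(unit_eps.1).
apply: vge_integral_mul => //; first by apply/vunit_vge0/vunitV.
exact: vge_weaken A_bad.
Qed.

Local Ltac integrality :=
  lazymatch goal with
  | |- vge v 0 (_ + _) => apply: dv_add => //; integrality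
  | |- vge v 0 (- _) => apply: vgeN => //; integrality
  | |- vge v 0 (_ * _) => apply: vge_integral_mul => //; integrality
  | |- vge v 0 (_ ^+ _) => apply: vgeX => //; integrality
  | |- vge v 0 (_%:R) => exact: vge0_nat
  | |- _ => try assumption
  end.

(** s^-6 f(r + s X) = 400 j^2 s^-6 G(1 + (s / r) X).  By [sextic_comp_shift] and
    [w_sub1] its coefficient of X^i has s with exponent i - 6 from the
    substitution and 2 ceil((6 - i) / 2) from the powers of w - 1, so 0 or 1 in
    total. *)
Lemma bad_prime_integral :
  Defs.integral_poly v (s ^- 6 *: (scaled_sextic j \Po (s *: 'X + r%:P))).
Proof.
have /eqP nz_r := vunit_r.1.
have int_w : vge v 0 w.
  rewrite /param_w; apply: vge_integral_mul => //; first exact/vunit_vge0/vunit_729j5.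
  exact/vunit_vge0/vunitV/vunit_D.
have int_ri : vge v 0 r^-1 by apply/vunit_vge0/vunitV/vunit_r.
have int_e : vge v 0 (eps / D).
  by apply/vunit_vge0/vunitM => //; apply/vunitV => //; exact: vunit_D.
have int_s := int_s.
rewrite /scaled_sextic comp_polyZ -comp_polyA.
have -> : (r^-1 *: 'X + 0%:P) \Po (s *: 'X + r%:P) = (s / r) *: 'X + 1%:P.
  rewrite addr0 comp_polyZ comp_polyX scalerDr scalerA mulrC; congr (_ + _).
  by rewrite -mul_polyC -polyCM mulVf.
rewrite sextic_comp_shift w_sub1.
move: w (r^-1) (eps / D) int_w int_ri int_e => w0 ri e0 int_w int_ri int_e i.
rewrite !coefZ coef_Poly; set k := 400 * j ^+ 2.
have int_k : vge v 0 k by rewrite /k; integrality.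
case: i => [|[|[|[|[|[|[|i]]]]]]] /=.
- rewrite [X in vge _ _ X](_ : _ = k * (e0 ^+ 3 * (4 * w0 - 13)));
    [integrality | by field].
- rewrite [X in vge _ _ X](_ : _ = k * (ri * s * e0 ^+ 3 * (24 * w0 - 18)));
    [integrality | by field].
- rewrite [X in vge _ _ X](_ : _ = k * (ri ^+ 2 * e0 ^+ 2 * (60 * w0 ^+ 2 - 15 * w0)));
    [integrality | by field].
- rewrite [X in vge _ _ X](_ : _ = k * (ri ^+ 3 * s * e0 ^+ 2 * (80 * w0 ^+ 2 + 20 * w0)));
    [integrality | by field].
- rewrite [X in vge _ _ X](_ : _ = k * (ri ^+ 4 * e0 * (60 * w0 ^+ 3 - 75 * w0 ^+ 2)));
    [integrality | by field].
- rewrite [X in vge _ _ X](_ : _ = k * (ri ^+ 5 * s * e0 * (24 * w0 ^+ 3 - 66 * w0 ^+ 2)));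
    [integrality | by field].
- rewrite [X in vge _ _ X](_ : _ = k * (ri ^+ 6 * (16 * w0 ^+ 2 - 25 * w0 ^+ 3
    + 4 * w0 ^+ 4)));
    [integrality | by field].
by rewrite nth_nil !mulr0; left.
Qed.
End BadPrime.

(** Scaling f by 4 s^-6 multiplies its discriminant by 4^10 s^-60, and the
    substitution of r + s X by s^30. *)
Lemma wdisc_scaled (F : fieldType) (W : weierstrass F) (s r : F)
    (f := 4 *: wP W + wQ W ^+ 2) :
  2 != 0 :> F -> 6 != 0 :> F -> s != 0 -> size f = 7 ->
  wdisc (Weierstrass 0 (s ^- 6 *: (f \Po (s *: 'X + r%:P)))) =
    2 ^+ 20 * s ^- 30 * wdisc W.
Proof.
move=> nz2 nz6 nz_s sf; rewrite /wdisc /= expr0n addr0 scalerA -/f.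
have nz4 : 4 != 0 :> F by rewrite (natrM _ 2 2) mulf_neq0.
have nz_c : 4 * s ^- 6 != 0 by rewrite mulf_neq0 // invr_eq0 expf_neq0.
rewrite /disc6 !coef6_neq0 ?size_scale ?size_comp_affine //.
rewrite (@discr_affine _ 5) //; move: (discr f) => d.
by field; rewrite nz_s andbT (natrX _ 2 12) expf_neq0.
Qed.

(** At a prime where A is a unit the equation itself has good reduction, its
    discriminant being - A^15; at the other primes one uses s^-6 f(r + s X), of
    discriminant - 2^20 eps^15, where eps is the sign in A = eps s^2. *)
Lemma good_model (F : numFieldType) (j A : F) (W : weierstrass F) (m : int)
    (Kp : fieldType) (v : Kp -> int) (phi : {rmorphism F -> Kp}) (eps s : Kp) :
  let f := 4 *: wP W + wQ W ^+ 2 in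
  f = scaled_sextic j -> size f = 7 -> wdisc W = - A ^+ 15 ->
  A = radic j ->
  (size (wQ W) <= 4)%N -> (size (wP W) <= 7)%N ->
  (forall i, is_integer (wP W)`_i) -> (forall i, is_integer (wQ W)`_i) ->
  is_integer j -> A = (20 * m + 13)%:~R ->
  discrete_valuation v -> vunit v eps -> phi A = eps * s ^+ 2 ->
  exists W' : weierstrass Kp,
    [/\ same_curve (base_change phi W) W',
        Defs.integral_poly v (wP W'), Defs.integral_poly v (wQ W')
      & vunit v (wdisc W')].
Proof.
move=> f fE sz disc AE sQ sP intP intQ int_j radE dv unit_eps radE'.
have nz_nat n : n.+1%:R != 0 :> Kp.
  by rewrite -(rmorph_nat phi) fmorph_eq0 pnatr_eq0.
have int_phi (x : F) : is_integer x -> vge v 0 (phi x).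
  by move=> [n ->]; rewrite rmorph_int; apply: vge0_int.
set Wp := base_change phi W; pose fp := 4 *: wP Wp + wQ Wp ^+ 2.
have fpE : fp = scaled_sextic (phi j).
  by rewrite /fp base_change_sextic -map_scaled_sextic -fE.
have sfp : size fp = 7 by rewrite /fp base_change_sextic size_map_poly.
have discWp : wdisc Wp = - phi A ^+ 15.
  rewrite (wdisc_map phi _ sz) ?pnatr_eq0 // disc.
  by rewrite rmorphN rmorphXn.
have radEp : phi A = 20 * m%:~R + 13.
  by rewrite radE rmorph_int rmorphD rmorphM /=.
have nz_rad : phi A != 0.
  by rewrite fmorph_eq0 radE intr_eq0; apply/eqP; lia.
have nz_discWp : wdisc Wp != 0 by rewrite discWp oppr_eq0 expf_neq0.
have [|||||L [iotaL [x [y ff]]]] := @function_field_exists Kp Wp.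
- exact: nz_nat.
- by rewrite /= size_map_poly.
- by rewrite /= size_map_poly.
- exact: coprime_of_wdisc.
- by rewrite -/fp sfp.
have int_rad : vge v 0 (phi A) by apply: int_phi; rewrite radE; exists (20 * m + 13).
have [bad|good] := vge_decidable v 1 (phi A); last first.
  have unit_rad := not_vge1_vunit int_rad good.
  exists Wp; split.
  - by exists L, iotaL, x, y, x, y.
  - by move=> i; rewrite coef_map; apply: int_phi.
  - by move=> i; rewrite coef_map; apply: int_phi.
  by rewrite discWp; apply: vunitN => //; apply: vunitX.
have nz_s : s != 0.
  by apply: contra nz_rad => /eqP s0; rewrite radE' s0 expr0n mulr0.
have radEj : radic (phi j) = phi A by rewrite AE map_radic.
have u2 : vunit v 2.
  by apply: (@vunit2 _ _ (phi j) m%:~R) => //; rewrite ?radEj //; apply: vge0_int.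
exists (Weierstrass 0 (s ^- 6 *: (fp \Po (s *: 'X + (param_r (phi j))%:P)))); split.
- exists L, iotaL, x, y; do 2 eexists; split; first exact: ff.
  by apply: change_coordinates ff => //; rewrite ?nz_nat // -/fp sfp.
- rewrite fpE; apply: (@bad_prime_integral _ _ _ _ eps m%:~R) => //; rewrite ?radEj //.
  + exact: int_phi.
  + exact: vge0_int.
- by move=> i; rewrite coef0; left.
rewrite wdisc_scaled ?nz_nat // discWp radE'.
have -> : 2 ^+ 20 * s ^- 30 * - (eps * s ^+ 2) ^+ 15 = - (2 ^+ 20 * eps ^+ 15) :> Kp.
  by field.
by apply: vunitN => //; apply: vunitM => //; apply: vunitX.
Qed.

(** * The family over quadratic fields *)

Lemma size_family_P (F : fieldType) (j : F) : (size (family_P j) <= 7)%N.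
Proof.
rewrite /family_P.
move: (4096 * _ - _ + _) (864 * _ * _ - _) (1 / 4 + _ + _) => a b c.
move: (32 * _ * _ + _) (135 * _ * _) (16 * _ + _) (500 * _) => d e g h.
 apply/leq_sizeP => i lt_i.
rewrite !(coefD, coefN, coefB, coefZ, coefXn, coefX, coefC).
do 7![case: i lt_i => // i lt_i].
by rewrite /= !(mulr0, subr0, addr0).
Qed.

Lemma size_family_Q (F : fieldType) : (size (- 'X^2 : {poly F}) <= 4)%N.
Proof. by rewrite size_polyN size_polyXn. Qed.

(** A = 20 m + 13 is not zero, so neither is the discriminant. *)
Lemma genus_of_disc (F : numFieldType) (W : weierstrass F) (A : F) (m : int) :
  (size (wQ W) <= 4)%N -> (size (wP W) <= 7)%N ->
  size (4 *: wP W + wQ W ^+ 2) = 7 -> wdisc W = - A ^+ 15 -> A = (20 * m + 13)%:~R ->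
  describes_genus 2 W.
Proof.
move=> sQ sP sf disc AE; apply: describes_genus_two => //; first by rewrite pnatr_eq0.
apply: coprime_of_wdisc => //; rewrite disc oppr_eq0 expf_neq0 // AE intr_eq0.
by apply/eqP; lia.
Qed.

Lemma signed_square (F K L : fieldType) (f : {rmorphism F -> K}) (g : {rmorphism K -> L})
    (b : bool) (a : F) (s : K) :
  s ^+ 2 = f ((-1) ^+ b * a) -> g (f a) = (-1) ^+ b * g s ^+ 2.
Proof.
move=> s2; rewrite -rmorphXn s2 -[in RHS](rmorph_sign g) -[in RHS](rmorph_sign f).
by rewrite -!rmorphM signrMK.
Qed.

Unset Implicit Arguments.
Theorem theorem7p1 (t : int) :
  describes_genus 2 (E (jt t)) /\
  (forall (b : bool) (K : fieldExtType rat) (s : K),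
     s ^+ 2 = in_alg K ((-1) ^+ b * radicand (jt t)) ->
     <<1; s>>%VS = {:K}%VS ->
     everywhere_good_reduction (base_change (in_alg K) (E (jt t)))).
Proof.
have [sf disc intP intQ [m radE]] := family_facts t.
have sQ : (size (wQ (E (jt t))) <= 4)%N := size_family_Q rat.
have sP : (size (wP (E (jt t))) <= 7)%N := size_family_P (jt t).
split; first exact: (genus_of_disc sQ sP sf disc radE).
move=> b K s s2 _ p _ Kp iota v [dv _ _ _ _].
pose phi : {rmorphism rat -> Kp} := iota \o in_alg K.
have nz_j : jt t != 0 := parameter_neq0 rat t.
have int_j : is_integer (jt t) := is_integer_intr rat (20 * t - 3).
have sign : vunit v ((-1) ^+ b) := vunitX dv b (vunitN dv (vunit1 dv)).
have AE : radicand (jt t) = radic (jt t) := erefl.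
move: (radicand (jt t)) AE disc radE s2 => A AE disc radE s2.
have radE' : phi A = (-1) ^+ b * iota s ^+ 2 :=
  @signed_square _ _ _ (in_alg K) iota b A s s2.
have := good_model (family_sextic nz_j) sf disc AE sQ sP intP intQ int_j radE dv sign radE'.
by rewrite /base_change -!map_poly_comp.
Qed.
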